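(* Let $\mathcal{I}$ be a Noetherian graded family of monomial ideals in $R = \Bbbk[x_1,\dots,x_n]$. Let $\Delta(\mathcal{I})$ and $\ell(\mathcal{I})$ be its Newton-Okounkov body and analytic spread, respectively. Then $$\ell(\mathcal{I}) = \mathrm{mdc}(\Delta(\mathcal{I})) + 1.$$
   Context: $\Bbbk$ is a field, $R = \Bbbk[x_1,\dots,x_n]$, $\mathfrak{m} = (x_1,\dots,x_n)$, and $\mathbb{N}$ denotes the positive integers. For $\mathbf{a} \in \mathbb{Z}^n_{\ge 0}$, $x^{\mathbf a} = x_1^{a_1}\cdots x_n^{a_n}$. A collection $\mathcal{I} = \{I_k\}_{k\in\mathbb{N}}$ of ideals of $R$ is a graded family if $I_p I_q \subseteq I_{p+q}$ for all $p,q$; one sets $I_0 = R$. The Rees algebra of $\mathcal{I}$ is $\mathcal{R}(\mathcal{I}) = \bigoplus_{k\ge 0} I_k t^k \subseteq R[t]$; $\mathcal{I}$ is called Noetherian if $\mathcal{R}(\mathcal{I})$ is a Noetherian ring. The analytic spread of $\mathcal{I}$ is $\ell(\mathcal{I}) = \dim\big(\mathcal{R}(\mathcal{I})/\mathfrak{m}\mathcal{R}(\mathcal{I})\big)$ (Krull dimension). The Newton-Okounkov body of $\mathcal{I}$ is $\Delta(\mathcal{I}) = \overline{\bigcup_{k\in\mathbb{N}} \{\mathbf{a}/k : x^{\mathbf{a}} \in I_k\}} \subseteq \mathbb{R}^n$ (topological closure); it is a polyhedron (intersection of finitely many closed half-spaces) when $\mathcal{I}$ is Noetherian. For a polyhedron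 $P$, $\mathrm{mdc}(P)$ is the maximum dimension of a compact face of $P$ (with $\mathrm{mdc}(\emptyset) = -1$). *)

(* Defs.v *)
From HB Require Import structures.
From mathcomp Require Import all_boot all_order all_algebra.
From mathcomp Require Import ring_quotient.
(* mpoly has to be imported before the analysis files: the notations clash in
   the other order. *)
From mathcomp Require Import mpoly.
From mathcomp Require Import boolp classical_sets reals ereal topology normedtype.

Set Implicit Arguments.
Unset Strict Implicit.
Unset Printing Implicit Defensive.

Import Order.TTheory GRing.Theory Num.Theory.
Import numFieldNormedType.Exports.

Local Open Scope classical_set_scope.
Local Open Scope ring_scope.

Section CommutativeAlgebra.
Variable A : comNzRingType.

(* The unit ideal is allowed, unlike in ring_quotient's idealr. *)
Definition is_ideal (J : set A) : Prop :=
  [/\ J 0, forall x y, J x -> J y -> J (x + y)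
    & forall a x, J x -> J (a * x)].

Definition ideal_span (G : set A) : set A := smallest is_ideal G.

Definition ideal_mul (J L : set A) : set A :=
  ideal_span [set x * y | x in J & y in L].

Definition noetherian_ring : Prop :=
  forall J : set A, is_ideal J -> exists s : seq A, J = ideal_span [set` s].

(* Strictly increasing chains P_0 < ... < P_m of (proper) prime ideals. *)
Definition prime_chain (m : nat) (P : 'I_m.+1 -> prime_idealr A) : Prop :=
  forall i j : 'I_m.+1, (i < j)%N ->
    [set x | x \in P i] `<` [set x | x \in P j].

(* A supremum of natural numbers, +oo if there are arbitrarily long chains;
   R only provides the extended numbers \bar R. *)
Definition krull_dim (R : realType) : \bar R :=
  ereal_sup [set (m%:R)%:E | m in [set m | exists P, @prime_chain m P]].

Lemma ideal_span_is_ideal (G : set A) : is_ideal (ideal_span G).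
Proof.
split=> [J [[J0 _ _] _] //|x y Jx Jy J JG|a x Jx J JG].
  by have [[_ JD _] _] := JG; apply: JD; [apply: Jx|apply: Jy].
by have [[_ _ JM] _] := JG; apply: JM; apply: Jx.
Qed.

End CommutativeAlgebra.

Section GradedFamilies.
Variables (K : fieldType) (n : nat).

(* The irrelevant ideal (x_1, ..., x_n). *)
Definition max_ideal : set {mpoly K[n]} :=
  ideal_span [set 'X_i | i in [set: 'I_n]].

Definition monomial_ideal (J : set {mpoly K[n]}) : Prop :=
  exists G : set 'X_{1..n}, J = ideal_span [set 'X_[a] | a in G].

(* Indexed by all of nat, with the convention I_0 = {mpoly K[n]}; the
   inclusions with p = 0 or q = 0 hold for any family of ideals. *)
Record graded_family := GradedFamily {
  gf_fun :> nat -> set {mpoly K[n]};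
  gf_ideal : forall k, is_ideal (gf_fun k);
  gf0 : gf_fun 0 = [set: {mpoly K[n]}];
  gf_mul : forall p q, ideal_mul (gf_fun p) (gf_fun q) `<=` gf_fun (p + q)
}.

End GradedFamilies.

Section Rees.
Variables (K : fieldType) (n : nat) (I : graded_family K n).

Definition in_rees : {pred {poly {mpoly K[n]}}} :=
  fun f => `[< forall k, I k f`_k >].

Lemma in_reesP (f : {poly {mpoly K[n]}}) : reflect (forall k, I k f`_k) (f \in in_rees).
Proof. exact: asboolP. Qed.

Lemma in_rees_subring : subring_closed in_rees.
Proof.
split=> [|f g /in_reesP If /in_reesP Ig|f g /in_reesP If /in_reesP Ig];
    apply/in_reesP => k.
- rewrite coef1; case: k => [|k]; first by rewrite gf0.
  by have [] := gf_ideal I k.+1.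
- have [_ ID IM] := gf_ideal I k; rewrite coefB; apply: ID => //.
  by rewrite -mulN1r; apply: IM.
- have [I0 ID IM] := gf_ideal I k; rewrite coefM.
  apply: (big_ind (I k)) => // i _.
  have := @gf_mul _ _ I i (k - i); rewrite subnKC -1?ltnS //; apply.
  by move=> J [_]; apply; exists f`_i => //; exists g`_(k - i).
Qed.

HB.instance Definition _ :=
  GRing.isSubringClosed.Build {poly {mpoly K[n]}} in_rees in_rees_subring.

(* The Rees algebra, a subring of {mpoly K[n]}[t]. *)
Record rees := Rees {
  rees_val :> {poly {mpoly K[n]}};
  rees_valP : rees_val \in in_rees
}.

HB.instance Definition _ := [isSub for rees_val].
HB.instance Definition _ := [Choice of rees by <:].
HB.instance Definition _ := [SubChoice_isSubComNzRing of rees by <:].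

(* The extension of the irrelevant ideal to the Rees algebra. *)
Definition rees_max : set rees :=
  ideal_span [set s : rees | exists2 p, @max_ideal K n p & rees_val s = p%:P].

Definition in_rees_max : {pred rees} := fun s => `[< rees_max s >].

Lemma in_rees_maxP s : reflect (rees_max s) (s \in in_rees_max).
Proof. exact: asboolP. Qed.

Lemma max_ideal_mcoeff0 p : @max_ideal K n p -> p@_0%MM = 0.
Proof.
pose J := [set q : {mpoly K[n]} | q@_0%MM = 0].
move=> /(_ J); apply; split; last first.
  by move=> _ [i _ <-]; rewrite /J /= mcoeffX -mdeg_eq0 mdeg1.
split=> [|q r /= q0 r0|q r /= r0]; first by rewrite /J /= mcoeff0.
  by rewrite /J /= mcoeffD q0 r0 addr0.
by rewrite /J /= (rmorphM (mcoeff 0%MM)) /= r0 mulr0.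
Qed.

Lemma in_rees_max_idealr : idealr_closed in_rees_max.
Proof.
have [J0 JD JM] :
  is_ideal rees_max := ideal_span_is_ideal _.
split=> [||a x y /in_rees_maxP Jx /in_rees_maxP Jy]; first exact/in_rees_maxP.
  apply/in_rees_maxP => H.
  pose J := [set s : rees | ((rees_val s)`_0)@_0%MM = 0].
  suff /H : is_ideal J /\ [set s : rees | exists2 p, @max_ideal K n p &
      rees_val s = p%:P] `<=` J.
    by rewrite /J /= coef1 /= mcoeff1 eqxx => /eqP; rewrite oner_eq0.
  split; last first.
    by move=> s [p mp sE]; rewrite /J /= sE coefC /= max_ideal_mcoeff0.
  split=> [|q r /= q0 r0|q r /= r0]; rewrite /J /=.
  - by rewrite coef0 mcoeff0.
  - by rewrite coefD mcoeffD q0 r0 addr0.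
  - by rewrite coef0M (rmorphM (mcoeff 0%MM)) /= r0 mulr0.
by apply/in_rees_maxP; apply: JD => //; apply: JM.
Qed.

HB.instance Definition _ :=
  isIdealr.Build rees in_rees_max in_rees_max_idealr.

Definition noetherian_family : Prop := noetherian_ring rees.

Definition analytic_spread (R : realType) : \bar R :=
  krull_dim {ideal_quot in_rees_max} R.

Definition newton_okounkov (R : realType) : set 'rV[R]_n :=
  closure [set v : 'rV[R]_n | exists (k : nat) (a : 'X_{1..n}),
    [/\ (0 < k)%N, I k 'X_[a] & v = k%:R^-1 *: \row_i (a i)%:R]].

End Rees.

Arguments newton_okounkov {K n} I R _ : assert.

Section Faces.
Variables (R : realType) (n : nat).
Implicit Types P F : set 'rV[R]_n.

(* c = 0 yields the two improper faces P (b = 0) and set0 (b < 0). *)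
Definition is_face P F : Prop :=
  exists (c : 'rV[R]_n) (b : R),
    (forall x, P x -> b <= \sum_i c 0 i * x 0 i) /\
    F = [set x | P x /\ \sum_i c 0 i * x 0 i = b].

(* The points are the rows of X. *)
Definition affinely_independent m (X : 'M[R]_(m, n)) : Prop :=
  forall u : 'I_m -> R,
    \sum_i u i = 0 -> \sum_i u i *: row i X = 0 -> forall i, u i = 0.

(* Dimension of the affine hull: one less than the maximal number of affinely
   independent points of F, which is at most n + 1; it is -1 for set0. *)
Definition aff_dim F : int :=
  (\max_(m < n.+2 | `[< exists X : 'M[R]_(m, n),
      (forall i, F (row i X)) /\ affinely_independent X >]) m)%N%:Z - 1.

(* A supremum over a nonempty set of integers in [-1, n], hence a maximum. *)
Definition mdc P : \bar R :=
  ereal_sup [set ((aff_dim F)%:~R)%:E |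
    F in [set F | is_face P F /\ compact F]].

End Faces.

(* Main.v *)
Require Import Defs.
From HB Require Import structures.
From mathcomp Require Import all_boot all_order all_algebra.
From mathcomp Require Import ring_quotient.
From mathcomp Require Import mpoly.
From mathcomp Require Import boolp classical_sets reals ereal topology.
From mathcomp Require Import normedtype.
From mathcomp Require Import ring lra zify.

(* Let S be the monoid of the exponents of the monomials x^a t^k in the Rees
   algebra; it is finitely generated because the algebra is Noetherian.  Both
   sides are compared with the ranks of the faces T of S that contain the
   exponent of none of the x_i.

   A compact nonempty face of the body is cut out by a functional c with
   positive coordinates, since the body is stable under adding nonnegative
   vectors; the weight c.a - b k is nonnegative on S and its zeros form such a
   face T.  Its rank bounds the number of affinely independent points of the
   given face, and killing the monomials outside T, then setting more and more
   variables to 1, yields a chain of primes whose length is the rank of T.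

   Conversely, given a chain of primes, the monomials outside its first prime P
   form a face T.  Elements picked in the successive differences of the chain
   are algebraically independent modulo P, and counting monomials bounds their
   number by the rank of T.  Motzkin's transposition theorem provides a weight
   that vanishes exactly on T, hence a compact face of the body. *)

Set Implicit Arguments.
Unset Strict Implicit.
Unset Printing Implicit Defensive.

Import Order.TTheory GRing.Theory Num.Theory.
Import numFieldNormedType.Exports.

Local Open Scope classical_set_scope.
Local Open Scope ring_scope.

(** * Linear inequalities *)

Section Gordan.
Variables (F : realFieldType) (I : eqType) (N : nat).
Implicit Types (b : I -> 'rV[F]_N) (y : 'cV[F]_N) (l : seq I).

Local Notation "u \dot y" := ((u *m (y : 'cV[F]_N)) 0 0) (at level 40).

Lemma mul00D (u : 'rV[F]_N) (y z : 'cV[F]_N) : u \dot (y + z) = u \dot y + u \dot z.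
Proof. by rewrite mulmxDr mxE. Qed.

Lemma mul00Z (u : 'rV[F]_N) a (z : 'cV[F]_N) : u \dot (a *: z) = a * (u \dot z).
Proof. by rewrite -scalemxAr mxE. Qed.

Lemma mul00Dl (u v : 'rV[F]_N) y : (u + v) \dot y = u \dot y + v \dot y.
Proof. by rewrite mulmxDl mxE. Qed.

Lemma mul00Zl a (u : 'rV[F]_N) y : (a *: u) \dot y = a * (u \dot y).
Proof. by rewrite -scalemxAl mxE. Qed.

(** Any positive [e] with [e * (1 + |g i|) <= f i] works for the index [i], and finitely many such
    bounds have a positive minimum. *)
Lemma perturb_pos (l : seq I) (f g : I -> F) :
  (forall i, i \in l -> 0 < f i) ->
  exists2 e, 0 < e & forall i, i \in l -> 0 < f i + e * g i.
Proof.
elim: l => [|i l IH] fpos; first by exists 1.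
have [|e e0 He] := IH; first by move=> j jl; apply: fpos; rewrite inE jl orbT.
have fi : 0 < f i by apply: fpos; rewrite inE eqxx.
pose d := f i / (1 + `|g i|).
have gi : 0 < 1 + `|g i| by rewrite ltr_wpDr // ltr01.
have d0 : 0 < d by rewrite divr_gt0.
exists (Num.min e d) => [|j]; first by rewrite lt_min e0 d0.
have m0 : 0 < Num.min e d by rewrite lt_min e0 d0.
rewrite inE => /predU1P[->|jl].
  have : Num.min e d <= d by rewrite ge_min lexx orbT.
  rewrite /d ler_pdivlMr // => H.
  have := ler_norm (- g i); rewrite normrN; nra.
have := He _ jl; have := fpos j; rewrite inE jl orbT => /(_ isT).
have : Num.min e d <= e by rewrite ge_min lexx.
move: m0 (g j) (f j) => /=; move: (Num.min e d) => t t0 u v te v0 H.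
have [u0|u0] := leP 0 u; last by nra.
by rewrite ltr_wpDr // mulr_ge0 // ltW.
Qed.

(** Gordan's alternative, by induction on the list. A solution [y] for the tail that is nonnegative
    on [b i0] is perturbed towards the transpose of [b i0]; if [y] is negative on [b i0], the tail
    is projected along [b i0] and the induction hypothesis is used again. *)
Lemma gordan b l : uniq l ->
  (exists y, forall i, i \in l -> 0 < b i \dot y) \/
  (exists mu : I -> F, [/\ forall i, 0 <= mu i,
     exists2 i, i \in l & 0 < mu i & \sum_(i <- l) mu i *: b i = 0]).
Proof.
elim: l b => [|i0 l IH] b /=; first by left; exists 0.
case/andP=> i0l ul.
have ext (mu : I -> F) (a : F) : 0 <= a -> (forall i, 0 <= mu i) ->
    (exists2 i, i \in i0 :: l & 0 < (if i == i0 then a else mu i)) ->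
    \sum_(i <- l) mu i *: b i + a *: b i0 = 0 ->
    exists mu : I -> F, [/\ forall i, 0 <= mu i,
     exists2 i, i \in i0 :: l & 0 < mu i & \sum_(i <- i0 :: l) mu i *: b i = 0].
  move=> a0 mu0 ex E; exists (fun i => if i == i0 then a else mu i); split => //.
    by move=> i; case: ifP.
  rewrite big_cons eqxx addrC -[RHS]E; congr (_ + _).
  apply: eq_big_seq => i il; case: eqP => // ii0; by rewrite -ii0 il in i0l.
have [[y Hy]|[mu [mu0 [i il mui] E]]] := IH b ul; last first.
  right; apply: (ext mu 0) => //; last by rewrite E scale0r addr0.
  exists i; first by rewrite inE il orbT.
  by case: eqP => // ii0; rewrite -ii0 il in i0l.
have cons_pos z : 0 < b i0 \dot z -> (forall i, i \in l -> 0 < b i \dot z) ->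
    exists y, forall i, i \in i0 :: l -> 0 < b i \dot y.
  by move=> H1 H2; exists z => i; rewrite inE => /predU1P[->|/H2].
have [b00|bN0] := eqVneq (b i0) 0.
  right; apply: (ext (fun=> 0) 1) => //.
    by exists i0; rewrite ?mem_head // eqxx.
  by rewrite b00 scaler0 addr0 big1 // => i _; rewrite scale0r.
pose z := (b i0)^T.
have bz : 0 < b i0 \dot z.
  rewrite mxE; have [j bj] : exists j, b i0 0 j != 0.
    apply/existsP; apply: contraNT bN0 => /existsPn H; apply/eqP/rowP => j.
    by rewrite mxE; apply/eqP; have := H j; rewrite negbK.
  rewrite (bigD1 j) //= /z mxE -expr2 ltr_pwDl ?exprn_even_gt0 //.
  by apply: sumr_ge0 => k _; rewrite mxE -expr2 sqr_ge0.
have finish y1 : 0 <= b i0 \dot y1 -> (forall i, i \in l -> 0 < b i \dot y1) ->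
    exists y, forall i, i \in i0 :: l -> 0 < b i \dot y.
  move=> y10 H; have [e e0 He] := perturb_pos (fun i => b i \dot z) H.
  apply: (cons_pos (y1 + e *: z)); rewrite ?mul00D ?mul00Z.
    by rewrite ltr_wpDl // mulr_gt0.
  by move=> i il; rewrite mul00D mul00Z; apply: He.
have [b0|b0] := leP 0 (b i0 \dot y); first by left; exact: (finish y).
(* This choice makes [b i + t i *: b i0] vanish on [y]. Since [t i] is positive on the tail, a
   nonnegative relation among the projected vectors is again one among the original vectors. *)
pose t i := (b i \dot y) / - (b i0 \dot y).
have [[y' Hy']|[mu [mu0 [i il mui] E]]] := IH (fun i => b i + t i *: b i0) ul.
  (* With this [s], [b i0] vanishes on [y' + s *: y], and [b i] takes there the value that its
     projection takes on [y']. *)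
  left; pose s := (b i0 \dot y') / - (b i0 \dot y).
  apply: (finish (y' + s *: y)).
    by rewrite mul00D mul00Z /s -mulrA invrN mulNr mulVf ?lt_eqF // mulrN1 subrr.
  move=> i il; have := Hy' _ il; rewrite mul00D mul00Z mul00Dl mul00Zl /s /t.
  by rewrite mulrAC [X in _ + X / _]mulrC mulrAC.
right; apply: (ext mu (\sum_(i <- l) mu i * t i)) => //.
- rewrite big_seq sumr_ge0 // => j jl; rewrite mulr_ge0 // divr_ge0 //.
    exact/ltW/Hy.
  by rewrite oppr_ge0 ltW.
- exists i; first by rewrite inE il orbT.
  by case: eqP => // ii0; rewrite -ii0 il in i0l.
- rewrite scaler_suml -big_split /= -[RHS]E; apply: eq_bigr => j _.
  by rewrite scalerDr scalerA.
Qed.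
End Gordan.

(** Gordan's alternative for the rows outside [T], taken modulo the span of the rows in [T]:
    multiplying by [cokermx A] passes to that quotient. A relation in the quotient lifts after a
    correction by rows in [T], whose coefficients may have any sign. *)
Lemma motzkin (F : realFieldType) q N (W : 'M[F]_(q, N)) (T : pred 'I_q) :
  (exists y : 'cV[F]_N, forall i,
     if T i then (W *m y) i 0 = 0 else 0 < (W *m y) i 0) \/
  (exists v : 'rV[F]_q, [/\ v *m W = 0, forall i, ~~ T i -> 0 <= v 0 i
     & exists2 i, ~~ T i & 0 < v 0 i]).
Proof.
pose A := \matrix_i (if T i then row i W else 0).
pose C := W *m cokermx A.
have entry (y : 'cV[F]_N) i : (C *m y) i 0 = (row i C *m y) 0 0.
  by rewrite -row_mul !mxE.
have [[y Hy]|[mu [mu0 [i iT mui] E]]] :=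
    gordan (fun i => row i C) (filter_uniq (predC T) (enum_uniq 'I_q)).
  left; exists (cokermx A *m y) => i; rewrite mulmxA -/C entry.
  case: ifPn => Ti; last by apply: Hy; rewrite mem_filter /= Ti mem_enum.
  rewrite row_mul; have -> : row i W = row i A by rewrite rowK Ti.
  by rewrite -row_mul mulmx_coker row0 mul0mx mxE.
right; pose v := \row_j (if T j then 0 else mu j).
have vC : v *m C = 0.
  rewrite -[RHS]E big_filter mulmx_sum_row big_enum_cond /= [RHS]big_mkcond /=.
  by apply: eq_bigr => j _; rewrite mxE; case: (T j); rewrite ?scale0r.
have /submxP[w vW] : (v *m W <= A)%MS by rewrite submxE -mulmxA vC.
have {}iT : ~~ T i by move: iT; rewrite mem_filter => /andP[].
exists (v - \row_j (if T j then w 0 j else 0)); split => [|j Tj|].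
- rewrite mulmxBl vW !mulmx_sum_row; apply/eqP; rewrite subr_eq0; apply/eqP.
  by apply: eq_bigr => j _; rewrite mxE rowK; case: (T j); rewrite ?scaler0 ?scale0r.
- by rewrite !mxE (negPf Tj) subr0.
- by exists i; rewrite // !mxE (negPf iT) subr0.
Qed.

(** Splitting into positive and negative parts turns a rational relation between exponents into an
    equality of two sums in the monoid. *)
Lemma clear_denominators q (v : 'I_q -> rat) :
  exists N, exists zp, exists zm : 'I_q -> nat, [/\ (0 < N)%N,
    forall i, N%:R * v i = (zp i)%:R - (zm i)%:R,
    forall i, 0 <= v i -> zm i = 0%N & forall i, 0 < v i -> (0 < zp i)%N].
Proof.
pose d i := `|denq (v i)|%N.
have dE i : (d i)%:R * v i = (numq (v i))%:~R.
  by rewrite numqE mulrC natr_absz gtr0_norm ?denq_gt0.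
have d_gt0 i : (0 < d i)%N by rewrite absz_gt0 denq_neq0.
pose M i := (\prod_(j | j != i) d j)%N.
have M_gt0 i : (0 < M i)%N by rewrite prodn_gt0.
exists (\prod_i d i)%N.
exists (fun i => if 0 <= v i then (M i * `|numq (v i)|)%N else 0%N).
exists (fun i => if 0 <= v i then 0%N else (M i * `|numq (v i)|)%N).
split => [|i|i ->//|i vi]; first by rewrite prodn_gt0.
- rewrite (bigD1 i) //= -/(M i) mulnC natrM -mulrA dE.
  case: leP => vi; rewrite ?subr0 ?sub0r natrM natr_absz.
    by rewrite ger0_norm ?numq_ge0.
  by rewrite ltr0_norm ?numq_lt0 // mulrNz mulrN opprK.
- by rewrite ltW // muln_gt0 M_gt0 absz_gt0 numq_eq0 gt_eqF.
Qed.

(** * Chains of primes and algebraic independence *)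

Section PrimeChainIndependence.
Variables (K : fieldType) (A : comNzRingType) (kap : {rmorphism K -> A}).

(* Order the monomials by the exponent of the first variable: cancelling the
   smallest power of f 0, which is not in P 0, and reducing modulo P 1, which
   contains f 0, leaves a relation between f 1, f 2, ... modulo P 1. *)
Lemma prime_chain_independent m (P : nat -> prime_idealr A) (f : nat -> A) :
  (forall i, (i < m)%N -> {subset P i <= P i.+1}) ->
  (forall i, (i < m)%N -> f i \notin P i) ->
  (forall i, (i < m)%N -> f i \in P i.+1) ->
  forall (E : finType) (Q : pred E) (e : E -> nat -> nat) (c : E -> K),
  (forall x y, Q x -> Q y -> (forall i, (i < m)%N -> e x i = e y i) -> x = y) ->
  \sum_(x | Q x) kap (c x) * \prod_(i < m) f i ^+ e x i \in P 0%N ->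
  forall x, Q x -> c x = 0.
Proof.
elim: m P f => [|m IH] P f Psub fN fP E Q e c eI HP x0 Qx0.
  apply/eqP; apply: contraT => cN0; move: HP.
  rewrite (bigD1 x0) //= big_ord0 mulr1 big1 ?addr0; last first.
    by move=> x /andP[Qx /eqP[]]; apply: eI.
  move=> H; have := idealMr (kap (c x0)^-1) H; rewrite -rmorphM mulVf // rmorph1.
  by rewrite idealr1.
apply/eqP; apply: contraT => cN0.
pose Q' := [pred x | Q x && (c x != 0)].
have Q'x0 : Q' x0 by rewrite /= Qx0.
have [x1 /andP[Qx1 cx1] x1min] := arg_minnP (fun x => e x 0%N) Q'x0.
set d := e x1 0%N in x1min.
pose G x := \prod_(i < m) f i.+1 ^+ e x i.+1.
have S1 : f 0%N ^+ d * (\sum_(x | Q' x) kap (c x) * (f 0%N ^+ (e x 0%N - d) * G x))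
    \in P 0%N.
  suff -> : f 0%N ^+ d * (\sum_(x | Q' x) kap (c x) * (f 0%N ^+ (e x 0%N - d) * G x))
    = \sum_(x | Q x) kap (c x) * \prod_(i < m.+1) f i ^+ e x i by [].
  rewrite mulr_sumr big_mkcondr /=; apply: eq_bigr => x Qx.
  case: eqP => [->|/eqP cx] /=; first by rewrite rmorph0 mul0r.
  rewrite big_ord_recl /= mulrCA; congr (_ * _).
  by rewrite mulrA -exprD subnKC // x1min //= Qx.
have fd : f 0%N ^+ d \notin P 0%N.
  elim: (d) => [|k IHk]; first by rewrite expr0 idealr1.
  by rewrite exprS prime_idealrM negb_or fN.
move: S1; rewrite prime_idealrM (negPf fd) /= => /Psub S1.
pose Q2 := [pred x | Q' x && (e x 0%N == d)].
have S2 : \sum_(x | Q2 x) kap (c x) * G x \in P 1%N.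
  have := S1 isT; rewrite (bigID (fun x => e x 0%N == d)) /= rpredDr; last first.
    apply: rpred_sum => x /andP[/andP[Qx cx] ed]; apply: idealMr.
    have : (0 < e x 0%N - d)%N by rewrite subn_gt0 ltn_neqAle eq_sym ed x1min //= Qx.
    case: (_ - d)%N => // k _; rewrite exprS -mulrA mulrC; apply: idealMr.
    exact: fP.
  rewrite (eq_bigr (fun x => kap (c x) * G x)) // => x /andP[_ /eqP ->].
  by rewrite subnn expr0 mul1r.
have := IH (fun i => P i.+1) (fun i => f i.+1) _ _ _ E Q2 (fun x i => e x i.+1) c.
move=> /(_ _ _ _ _ S2 x1) H.
suff /eqP : c x1 = 0 by rewrite (negPf cx1).
apply: H => [i|i|i|x y|].
- exact: (Psub i.+1).
- exact: (fN i.+1).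
- exact: (fP i.+1).
- move=> /andP[/andP[Qx _] /eqP ex] /andP[/andP[Qy _] /eqP ey] H.
  by apply: eI => // -[|i] im; rewrite ?ex ?ey // H.
by rewrite /= Qx1 cx1 eqxx.
Qed.
End PrimeChainIndependence.

(** The left side grows like the power [r] of [D], the right side like the power [m];
    [D = (C + 1)^r] is large enough to absorb the constant. *)
Lemma exists_exp_lt r m C : (r < m)%N -> exists D, ((D * C).+1 ^ r < D.+1 ^ m)%N.
Proof.
move=> rm; have [D CD] : exists D, D = (C.+1 ^ r)%N by exists (C.+1 ^ r)%N.
exists D.
apply: (@leq_ltn_trans ((D.+1 * C.+1) ^ r)).
  by case: (r) => // r'; rewrite leq_exp2r //; nia.
rewrite expnMn -CD; apply: (@leq_trans (D.+1 ^ r.+1)); last exact: leq_pexp2l.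
by rewrite expnSr ltn_pmul2l ?expn_gt0.
Qed.

(** A counting argument: the products of powers of the [h i] with exponents at most [D] outnumber
    the monomials in [r] variables with exponents at most [D * C], so their coefficient matrix has a
    nonzero left kernel. *)
Lemma mpoly_dependent (K : fieldType) r m (h : nat -> {mpoly K[r]}) :
  (r < m)%N -> exists D, exists2 c : {ffun 'I_m -> 'I_D} -> K,
    exists x, c x != 0 & \sum_x c x *: \prod_(i < m) h i ^+ x i = 0.
Proof.
move=> rm; pose C := (\sum_(i < m) msize (h i))%N.
have [D HD] := exists_exp_lt C rm.
exists D.+1; pose E := {ffun 'I_m -> 'I_D.+1}.
pose B := {ffun 'I_r -> 'I_(D * C).+1}.
have cE : (#|B| < #|E|)%N by rewrite !card_ffun !card_ord.
pose mon (b : B) : 'X_{1..r} := [multinom b i : nat | i < r].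
pose M : 'M[K]_(#|E|, #|B|) := \matrix_(x, b)
  (\prod_(i < m) h i ^+ (enum_val x : E) i)@_(mon (enum_val b)).
have : kermx M != 0.
  rewrite kermx_eq0 -row_leq_rank -ltnNge.
  exact: leq_ltn_trans (rank_leq_col _) cE.
case/rowV0Pn => v /sub_kermxP vM v0.
exists (fun x => v 0 (enum_rank x)).
  have /existsP[i vi] : [exists i, v 0 i != 0].
    apply: contraNT v0 => /existsPn H; apply/eqP/rowP => i.
    by rewrite mxE; apply/eqP; have := H i; rewrite negbK.
  by exists (enum_val i); rewrite enum_valK.
apply/mpolyP => k; rewrite mcoeff0 raddf_sum /=.
have [kB|/existsPn/= kB] := boolP [exists b : B, mon b == k].
  have /existsP[b /eqP <-] := kB.
  have := congr1 (fun u : 'rV_ _ => u 0 (enum_rank b)) vM.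
  rewrite !mxE => vM0; rewrite -[RHS]vM0.
  rewrite (reindex (@enum_val _ E)) /=; last first.
    by exists enum_rank => x _; rewrite ?enum_rankK ?enum_valK.
  by apply: eq_bigr => x _; rewrite mcoeffZ enum_valK mxE enum_rankK.
(* A monomial outside the box occurs in none of the products, since their total degree is at most
   [D * C]. *)
apply: big1 => x _; rewrite mcoeffZ memN_msupp_eq0 ?mulr0 //.
apply/negP => kx; have {kB} : ~~ (mdeg k <= D * C)%N.
  apply/negP => kC; have ki i : (k i < (D * C).+1)%N.
    rewrite ltnS (leq_trans _ kC) // mdegE (bigD1 i) //= leq_addr //.
  have /negP := kB [ffun i => Ordinal (ki i)]; apply.
  by apply/eqP/mnmP => i; rewrite mnmE ffunE.
case/negP; have := msize_mdeg_lt kx.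
have X (p : {mpoly K[r]}) q : ((msize (p * q)).-1 <= (msize p).-1 + (msize q).-1)%N.
  have [->|p0] := eqVneq p 0; first by rewrite mul0r msize0.
  have [->|q0] := eqVneq q 0; first by rewrite mulr0 msize0.
  rewrite msizeM // (mpolySpred mdeg p0) (mpolySpred mdeg q0).
  by rewrite addSn addnS.
have Xn (p : {mpoly K[r]}) j : ((msize (p ^+ j)).-1 <= j * msize p)%N.
  elim: j => [|j IHj]; first by rewrite expr0 msize1.
  rewrite exprS mulSn; exact: leq_trans (X _ _) (leq_add (leq_pred _) IHj).
have : ((msize (\prod_(i < m) h i ^+ x i)).-1 <= \sum_(i < m) D * msize (h i))%N.
  apply: (big_ind2 (fun (p : {mpoly K[r]}) a => (msize p).-1 <= a)%N).
  - by rewrite msize1.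
  - move=> p a q b pa qb; exact: leq_trans (X _ _) (leq_add pa qb).
  move=> i _; rewrite (leq_trans (Xn _ _)) // leq_mul2r.
  by rewrite -ltnS ltn_ord orbT.
rewrite -big_distrr /= -/C => le_C lt; apply: leq_trans le_C.
by rewrite -ltnS prednK // (leq_trans _ lt).
Qed.

(** * The Rees algebra as a monoid algebra *)

Section Monomials.
Variables (K : fieldType) (n : nat).
Implicit Types (m s : 'X_{1..n.+1}) (f g : {poly {mpoly K[n]}}).

(* The monomial x^a t^k is encoded by the vector (k, a). *)
Definition mhead m : nat := m ord0.
Definition mtail m : 'X_{1..n} := [multinom m (lift ord0 i) | i < n].
Definition mcons (k : nat) (a : 'X_{1..n}) : 'X_{1..n.+1} :=
  [multinom oapp (fun j => a j) k (unlift ord0 i) | i < n.+1].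

Lemma mhead_cons k a : mhead (mcons k a) = k.
Proof. by rewrite /mhead mnmE unlift_none. Qed.

Lemma mtail_cons k a : mtail (mcons k a) = a.
Proof. by apply/mnmP => i; rewrite !mnmE liftK. Qed.

Lemma mcons_eta m : mcons (mhead m) (mtail m) = m.
Proof.
by apply/mnmP => i; rewrite mnmE; case: unliftP => [j|] -> /=; rewrite ?mnmE.
Qed.

Lemma mheadD m s : mhead (m + s)%MM = (mhead m + mhead s)%N.
Proof. exact: mnmDE. Qed.

Lemma mtailD m s : mtail (m + s)%MM = (mtail m + mtail s)%MM.
Proof. by apply/mnmP => i; rewrite !mnmE. Qed.

Lemma mhead0 : mhead 0%MM = 0%N.
Proof. exact: mnm0E. Qed.

Lemma mtail0 : mtail 0%MM = 0%MM.
Proof. by apply/mnmP => i; rewrite !mnmE. Qed.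

Lemma mtail_neq0 m : mhead m = 0%N -> m != 0%MM -> exists i, mtail m i != 0%N.
Proof.
move=> h0 m0; apply/existsP; apply: contraNT m0 => /existsPn H; apply/eqP.
rewrite -(mcons_eta m) h0; apply/mnmP => j; rewrite mnmE mnm0E.
by case: unliftP => //= k _; apply/eqP; have := H k; rewrite negbK.
Qed.

Definition pcoef f m : K := f`_(mhead m)@_(mtail m).
Definition monom m : {poly {mpoly K[n]}} := 'X_[mtail m] *: 'X^(mhead m).
Definition psupp f :=
  [seq mcons k a | k <- iota 0 (size f), a <- msupp f`_k].

Lemma pcoef0 m : pcoef 0 m = 0.
Proof. by rewrite /pcoef coef0 mcoeff0. Qed.

Lemma pcoefD f g m : pcoef (f + g) m = pcoef f m + pcoef g m.
Proof. by rewrite /pcoef coefD mcoeffD. Qed.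

Lemma pcoefZ c f m : pcoef (c%:MP *: f) m = c * pcoef f m.
Proof. by rewrite /pcoef coefZ mcoeffCM. Qed.

Lemma pcoef_monom s m : pcoef (monom s) m = (s == m)%:R.
Proof.
rewrite /pcoef coefZ coefXn; case: eqP => [hE|hN]; last first.
  rewrite mulr0 mcoeff0; case: eqP => // sm; by rewrite sm in hN.
rewrite mulr1 mcoeffX; congr (_%:R); congr nat_of_bool.
by apply/eqP/eqP => [tE|->//]; rewrite -(mcons_eta s) -hE tE mcons_eta.
Qed.

Lemma pcoefP f g : (forall m, pcoef f m = pcoef g m) <-> f = g.
Proof.
split=> [H|-> //]; apply/polyP => k; apply/mpolyP => a.
by have := H (mcons k a); rewrite /pcoef mhead_cons mtail_cons.
Qed.

Lemma monom0 : monom 0%MM = 1.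
Proof. by rewrite /monom mtail0 mhead0 mpolyX0 expr0 scale1r. Qed.

Lemma monomD m s : monom (m + s)%MM = monom m * monom s.
Proof.
by rewrite /monom mtailD mheadD mpolyXD exprD -scalerAl -scalerAr scalerA.
Qed.

Lemma mem_psupp f m : (m \in psupp f) = (pcoef f m != 0).
Proof.
apply/allpairsPdep/idP => [[k [a [_ ak ->]]]|fm].
  by rewrite /pcoef mhead_cons mtail_cons -mcoeff_msupp.
exists (mhead m), (mtail m); rewrite mcons_eta mcoeff_msupp; split=> //.
rewrite mem_iota /= add0n ltnNge; apply: contra fm => /(nth_default 0) H.
by rewrite /pcoef H mcoeff0.
Qed.

Lemma psupp_uniq f : uniq (psupp f).
Proof.
apply: allpairs_uniq_dep; rewrite ?iota_uniq //.
move=> [k a] [l b] _ _ /= E; have := congr1 mhead E; have := congr1 mtail E.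
by rewrite !mhead_cons !mtail_cons => -> ->.
Qed.

Lemma poly_monomE f : f = \sum_(s <- psupp f) (pcoef f s)%:MP *: monom s.
Proof.
apply/pcoefP => m; rewrite (big_morph (pcoef^~ m) (fun f g => pcoefD f g m) (pcoef0 m)).
have [fm|fm] := boolP (m \in psupp f); last first.
  rewrite big_seq big1 => [|s sf]; last first.
    rewrite pcoefZ pcoef_monom; case: eqP => [sm|_]; last by rewrite mulr0.
    by rewrite sm (negPf fm) in sf.
  by apply/eqP; rewrite -[_ == _]negbK -mem_psupp.
rewrite (bigD1_seq m) ?psupp_uniq //= pcoefZ pcoef_monom eqxx mulr1.
rewrite big1 ?addr0 // => s /negPf sm; by rewrite pcoefZ pcoef_monom sm mulr0.
Qed.

Section LinearExtension.
Variables (V : lmodType K) (u : 'X_{1..n.+1} -> V).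

(** The [K]-linear map that sends the basis element [monom s] to [u s]. *)
Definition lext f : V := \sum_(s <- psupp f) pcoef f s *: u s.

Lemma lextE l f : uniq l -> (forall m, pcoef f m != 0 -> m \in l) ->
  lext f = \sum_(s <- l) pcoef f s *: u s.
Proof.
move=> ul fl; rewrite [RHS](bigID (mem (psupp f))) /= [X in _ + X]big1 ?addr0.
  rewrite -big_filter; apply/perm_big/uniq_perm; rewrite ?filter_uniq ?psupp_uniq //.
  move=> m; rewrite mem_filter /=; case: (boolP (m \in psupp f)) => //= fm.
  by rewrite fl // -mem_psupp.
by move=> s; rewrite mem_psupp negbK => /eqP ->; rewrite scale0r.
Qed.

Lemma lextD f g : lext (f + g) = lext f + lext g.
Proof.
pose l := undup (psupp f ++ psupp g).
have lP h : (forall m, pcoef f m = 0 -> pcoef g m = 0 -> pcoef h m = 0) ->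
    lext h = \sum_(s <- l) pcoef h s *: u s.
  move=> H; apply: lextE; rewrite ?undup_uniq // => m.
  rewrite mem_undup mem_cat !mem_psupp -negb_and; apply: contra => /andP[/eqP a /eqP b].
  by rewrite H.
rewrite !lP //; last by move=> m f0 g0; rewrite pcoefD f0 g0 addr0.
by rewrite -big_split; apply: eq_bigr => s _; rewrite pcoefD scalerDl.
Qed.

Lemma lextZ c f : lext (c%:MP *: f) = c *: lext f.
Proof.
rewrite (lextE (psupp_uniq f)) => [|m]; last first.
  by rewrite mem_psupp; apply: contra => /eqP fm; rewrite pcoefZ fm mulr0.
by rewrite scaler_sumr; apply: eq_bigr => s _; rewrite pcoefZ scalerA.
Qed.

Lemma lext0 : lext 0 = 0.
Proof. by apply: big1 => s _; rewrite pcoef0 scale0r. Qed.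

Lemma lextN f : lext (- f) = - lext f.
Proof. by apply/eqP; rewrite -addr_eq0 -lextD addNr lext0. Qed.

Lemma lext_monom s : lext (monom s) = u s.
Proof.
rewrite (@lextE [:: s]) // => [|m].
  by rewrite big_seq1 pcoef_monom eqxx scale1r.
by rewrite pcoef_monom; case: (s =P m) => [->|]; rewrite ?mem_head ?eqxx.
Qed.

Lemma lext_sum (I : Type) (r : seq I) (P : pred I) (F : I -> {poly {mpoly K[n]}}) :
  lext (\sum_(i <- r | P i) F i) = \sum_(i <- r | P i) lext (F i).
Proof. exact: (big_morph lext lextD lext0). Qed.

End LinearExtension.

(** Multiplicativity of [u] is asked on the supports only, because the maps used later are
    multiplicative on the monoid of the Rees algebra and not on all exponents. *)
Lemma lextM (V : comAlgType K) (u : 'X_{1..n.+1} -> V) f g :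
  (forall m s, m \in psupp f -> s \in psupp g -> u (m + s)%MM = u m * u s) ->
  lext u (f * g) = lext u f * lext u g.
Proof.
move=> uM; rewrite {1}(poly_monomE f) {1}(poly_monomE g) mulr_suml lext_sum.
rewrite [in RHS]/lext mulr_suml; apply: eq_big_seq => m mf.
rewrite !mulr_sumr lext_sum; apply: eq_big_seq => s sg.
rewrite -scalerAl -scalerAr !lextZ -monomD lext_monom uM //.
by rewrite -!scalerAl -!scalerAr.
Qed.

Lemma psuppM f g m : m \in psupp (f * g) ->
  exists a, exists2 b, a \in psupp f /\ b \in psupp g & m = (a + b)%MM.
Proof.
rewrite mem_psupp {1}(poly_monomE f) {1}(poly_monomE g) mulr_suml.
have S := big_morph (pcoef^~ m) (fun f g => pcoefD f g m) (pcoef0 m).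
apply: contraNP => H; rewrite S big_seq big1 // => a af.
rewrite mulr_sumr S big_seq big1 // => b bg.
rewrite -scalerAl -scalerAr !pcoefZ -monomD pcoef_monom.
case: eqP => [abm|_]; last by rewrite !mulr0.
by case: H; exists a, b.
Qed.

End Monomials.

Section QuotientKernel.
Variables (A : comNzRingType) (J : idealr A) (B : idomainType).
Variable phi : {rmorphism A -> B}.

Local Notation pi := \pi_{ideal_quot J}%qT.

(** The morphism factors through the quotient, and the kernel of a morphism to a domain is prime.
    Membership is tested on the chosen representative, whose image does not depend on the choice. *)
Lemma quot_kernel_prime : (forall x, x \in J -> phi x = 0) ->
  exists P : prime_idealr {ideal_quot J}, forall x, (pi x \in P) = (phi x == 0).
Proof.
move=> J0; pose Q : {pred {ideal_quot J}} := fun x => phi (repr x) == 0.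
have piE x : (pi x \in Q) = (phi x == 0).
  rewrite unfold_in /Q; have /eqP : pi (repr (pi x)) = pi x by rewrite reprK.
  rewrite -Quotient.idealrBE => /J0; rewrite rmorphB => /eqP.
  by rewrite subr_eq0 => /eqP ->.
have Qcl : idealr_closed Q.
  split=> [||a x y]; rewrite -?(rmorph0 pi) -?(rmorph1 pi) ?piE.
  - by rewrite rmorph0.
  - by rewrite rmorph1 oner_eq0.
  rewrite -[a]reprK -[x]reprK -[y]reprK -rmorphM -rmorphD !piE.
  by rewrite rmorphD rmorphM => /eqP -> /eqP ->; rewrite mulr0 addr0.
have Qpr : prime_idealr_closed Q.
  move=> x y; rewrite -[x]reprK -[y]reprK -rmorphM !piE.
  by rewrite rmorphM mulf_eq0.
pose P : prime_idealr {ideal_quot J} := HB.pack (Q : {ideal_quot J} -> bool)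
  (isIdealr.Build _ Q Qcl) (isPrimeIdealrClosed.Build _ Q Qpr).
by exists P => x; rewrite -piE.
Qed.

End QuotientKernel.

(** The polynomials all of whose monomials lie in [J] form an ideal that contains the monomial
    generators of [J]. *)
Lemma monomial_ideal_msupp (K : fieldType) n (J : set {mpoly K[n]}) p a :
  monomial_ideal J -> J p -> a \in msupp p -> J 'X_[a].
Proof.
case=> G ->; set J' := ideal_span _.
have [_ _ JM] : is_ideal J' by exact: ideal_span_is_ideal.
move=> Jp; move: a; pose Q :=
  [set p : {mpoly K[n]} | forall a, a \in msupp p -> J' 'X_[a]].
suff : Q p by [].
apply: Jp; split; last first.
  by move=> _ [b Gb <-] a; rewrite msuppX inE => /eqP ->; move=> L [_]; apply; exists b.
split=> [a|x y Qx Qy a|x y Qy a]; first by rewrite msupp0.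
  by move/msuppD_le; rewrite mem_cat => /orP[/Qx|/Qy].
move/msuppM_le/allpairsP => [[b c] /= [_ /Qy Jc ->]].
by rewrite mpolyXD; apply: JM.
Qed.

Section Rees.
Variables (K : fieldType) (n : nat) (I : graded_family K n).
Hypothesis I_monomial : forall k : nat, (0 < k)%N -> monomial_ideal (I k).
Implicit Types (m s : 'X_{1..n.+1}) (f : rees I).

Lemma rees_val_inj : injective (@rees_val K n I).
Proof. exact: val_inj. Qed.

Lemma rees_val0 : rees_val (0 : rees I) = 0.
Proof. exact: (rmorph0 val). Qed.

Lemma rees_val1 : rees_val (1 : rees I) = 1.
Proof. exact: (rmorph1 val). Qed.

Lemma rees_valD (x y : rees I) : rees_val (x + y) = rees_val x + rees_val y.
Proof. exact: (rmorphD val). Qed.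

Lemma rees_valB (x y : rees I) : rees_val (x - y) = rees_val x - rees_val y.
Proof. exact: (rmorphB val). Qed.

Lemma rees_valM (x y : rees I) : rees_val (x * y) = rees_val x * rees_val y.
Proof. exact: (rmorphM val). Qed.

(** The monoid S of the exponents of the Rees algebra. *)
Definition rmon m : bool := `[< I (mhead m) 'X_[mtail m] >].

Lemma rmon_mhead0 m : mhead m = 0%N -> rmon m.
Proof. by move=> m0; apply/asboolP; rewrite m0 gf0. Qed.

Lemma rmon0 : rmon 0%MM.
Proof. exact: rmon_mhead0 (mhead0 _). Qed.

Lemma rmonD m s : rmon m -> rmon s -> rmon (m + s)%MM.
Proof.
move=> /asboolP Im /asboolP Is; apply/asboolP; rewrite mheadD mtailD mpolyXD.
by apply: gf_mul => J [_]; apply; exists 'X_[mtail m] => //; exists 'X_[mtail s].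
Qed.

Lemma rmonMn m k : rmon m -> rmon (m *+ k)%MM.
Proof.
move=> Sm; elim: k => [|k IH]; first by rewrite mulm0n rmon0.
by rewrite mulmS rmonD.
Qed.

Lemma rmon_sum (T : Type) (r : seq T) (F : T -> 'X_{1..n.+1}) (w : T -> nat) :
  (forall i, rmon (F i)) -> rmon (\sum_(i <- r) F i *+ w i)%MM.
Proof.
move=> HF; apply: (big_ind rmon) => [||i _]; [exact: rmon0|exact: rmonD|].
exact: rmonMn.
Qed.

Lemma monom_in_rees m : rmon m -> monom K m \in in_rees I.
Proof.
move=> /asboolP Im; apply/in_reesP => k; have [I0 _ IM] := gf_ideal I k.
rewrite coefZ coefXn; case: eqP => [->|_]; rewrite ?mulr0 ?mulr1 //.
Qed.

(** This makes the Rees algebra the monoid algebra of S: its elements are combinations of monomials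
    that belong to it. *)
Lemma psupp_rees f m : m \in psupp (rees_val f) -> rmon m.
Proof.
have /in_reesP/(_ (mhead m)) := valP f.
rewrite mem_psupp -mcoeff_msupp => If mf; apply/asboolP.
have [h0|h0] := posnP (mhead m); first by rewrite h0 gf0.
exact: monomial_ideal_msupp (I_monomial h0) If mf.
Qed.

Lemma const_in_rees (c : K) : (c%:MP)%:P \in in_rees I.
Proof.
apply/in_reesP => k; rewrite coefC; have [I0 _ _] := gf_ideal I k.
by case: eqP => [->|//]; rewrite gf0.
Qed.

Definition rees_const (c : K) : rees I := Rees (const_in_rees c).

Lemma rees_const_is_zmod_morphism : zmod_morphism rees_const.
Proof. by move=> x y; apply: rees_val_inj; rewrite rees_valB /= mpolyCB polyCB. Qed.

Lemma rees_const_is_monoid_morphism : monoid_morphism rees_const.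
Proof.
split=> [|x y]; apply: rees_val_inj; first by rewrite rees_val1 /= mpolyC1 polyC1.
by rewrite rees_valM /= mpolyCM polyCM.
Qed.

HB.instance Definition _ :=
  GRing.isZmodMorphism.Build K (rees I) rees_const rees_const_is_zmod_morphism.
HB.instance Definition _ :=
  GRing.isMonoidMorphism.Build K (rees I) rees_const rees_const_is_monoid_morphism.

(** The default value 0 is taken when [m] is outside the monoid. *)
Definition rmonom m : rees I := insubd 0 (monom K m).

Lemma val_rmonom m : rmon m -> rees_val (rmonom m) = monom K m.
Proof. by move=> Im; rewrite insubdK // monom_in_rees. Qed.

Lemma rmonomD m s : rmon m -> rmon s -> rmonom (m + s)%MM = rmonom m * rmonom s.
Proof.
by move=> Im Is; apply: rees_val_inj; rewrite rees_valM !val_rmonom ?rmonD // monomD.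
Qed.

Lemma rmonom0 : rmonom 0%MM = 1.
Proof. by apply: rees_val_inj; rewrite val_rmonom ?rmon0 // monom0 rees_val1. Qed.

Lemma rees_monomE f :
  f = \sum_(s <- psupp (rees_val f)) rees_const (pcoef (rees_val f) s) * rmonom s.
Proof.
apply: rees_val_inj; rewrite {1}(poly_monomE (rees_val f)).
rewrite (big_morph _ rees_valD rees_val0) big_seq [RHS]big_seq.
apply: eq_bigr => s sf; rewrite rees_valM val_rmonom ?(psupp_rees sf) //=.
by rewrite mul_polyC.
Qed.

(** The universal property of the monoid algebra. *)
Lemma rees_morphism r (u : 'X_{1..n.+1} -> {mpoly K[r]}) : u 0%MM = 1 ->
  (forall m s, rmon m -> rmon s -> u (m + s)%MM = u m * u s) ->
  exists phi : {rmorphism rees I -> {mpoly K[r]}},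
    forall f, phi f = lext u (rees_val f).
Proof.
move=> u0 uD; pose g (f : rees I) := lext u (rees_val f).
have gB : zmod_morphism g by move=> x y; rewrite /g rees_valB lextD lextN.
have gM : monoid_morphism g.
  split=> [|x y]; first by rewrite /g rees_val1 -monom0 lext_monom.
  rewrite /g rees_valM lextM // => m s mx sy.
  by apply: uD; [apply: psupp_rees mx|apply: psupp_rees sy].
pose phi : {rmorphism rees I -> {mpoly K[r]}} := HB.pack g
  (GRing.isZmodMorphism.Build _ _ g gB) (GRing.isMonoidMorphism.Build _ _ g gM).
by exists phi.
Qed.

Lemma lext_rees_const r (u : 'X_{1..n.+1} -> {mpoly K[r]}) c : u 0%MM = 1 ->
  lext u (rees_val (rees_const c)) = c%:MP.
Proof.
move=> u0; rewrite /= -[_%:P]mulr1 mul_polyC -monom0 lextZ lext_monom u0.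
by rewrite -alg_mpolyC.
Qed.

(** The kernel is an ideal, and it contains the generators: they have degree 0 in t and no constant
    term, so [u] kills all their monomials. *)
Lemma lext_rees_max r (u : 'X_{1..n.+1} -> {mpoly K[r]}) f : u 0%MM = 1 ->
  (forall m s, rmon m -> rmon s -> u (m + s)%MM = u m * u s) ->
  (forall m, mhead m = 0%N -> m != 0%MM -> u m = 0) ->
  f \in @in_rees_max K n I -> lext u (rees_val f) = 0.
Proof.
move=> u0 uD ux /in_rees_maxP If; have [phi phiE] := rees_morphism u0 uD.
suff : [set g | phi g = 0] f by rewrite /= phiE.
apply: If; split; first split=> [|x y /= x0 y0|a x /= x0].
- exact: rmorph0.
- by rewrite rmorphD x0 y0 addr0.
- by rewrite rmorphM x0 mulr0.
move=> s [p mp sp]; rewrite /= phiE sp; apply: big1_seq => m /andP[_].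
rewrite mem_psupp /pcoef coefC; case: (mhead m =P 0%N) => [m0|]; last first.
  by rewrite mcoeff0 eqxx.
move=> pm; rewrite ux ?scaler0 //; apply: contraNneq pm => ->.
by rewrite mtail0 max_ideal_mcoeff0.
Qed.

Lemma rmonom_in_rees_max i : rmonom (mcons 0 U_(i)) \in @in_rees_max K n I.
Proof.
apply/in_rees_maxP => J [_]; apply; exists 'X_i.
  by move=> L [_]; apply; exists i.
rewrite -[rees_val _]/(rees_val _) val_rmonom ?rmon_mhead0 ?mhead_cons //.
by rewrite /monom mhead_cons mtail_cons expr0 alg_polyC.
Qed.

(** The elements without constant term form an ideal, which is generated by finitely many elements;
    the exponents occurring in these generate the monoid. *)
Lemma rees_finitely_generated : noetherian_family I ->
  exists q, exists2 G : 'I_q -> 'X_{1..n.+1}, forall i, rmon (G i)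
    & forall m, rmon m -> exists w : 'I_q -> nat, m = (\sum_i G i *+ w i)%MM.
Proof.
move=> noeth; pose J := [set f : rees I | pcoef (rees_val f) 0%MM = 0].
have Jid : is_ideal J.
  split=> [|x y Jx Jy|a x Jx]; rewrite /J /mkset.
  - by rewrite rees_val0 pcoef0.
  - by rewrite rees_valD pcoefD Jx Jy addr0.
  - rewrite rees_valM; apply/eqP; rewrite -[_ == _]negbK -mem_psupp; apply/negP.
    case/psuppM => b [c [_ cx]] /esym/eqP; rewrite mnmD_eq0 => /andP[_ /eqP c0].
    by move: cx; rewrite mem_psupp c0 Jx eqxx.
have [gs JE] := noeth J Jid.
pose L := flatten [seq psupp (rees_val g) | g <- gs].
have LP m : m \in L -> rmon m /\ m != 0%MM.
  case/flatten_mapP => g ggs mg; split; first exact: psupp_rees mg.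
  have Jg : J g by rewrite JE => H [_]; apply.
  by apply: contraTneq mg => ->; rewrite mem_psupp Jg eqxx.
(* Every exponent occurring in the ideal splits off a nonzero element of [L]; the induction on the
   degree below rests on this. *)
have Jdec f m : J f -> m \in psupp (rees_val f) ->
    exists2 a, a \in L & exists2 b, rmon b & m = (a + b)%MM.
  rewrite JE => Jf; move: m; pose Q := [set f : rees I | forall m,
    m \in psupp (rees_val f) -> exists2 a, a \in L & exists2 b, rmon b & m = (a + b)%MM].
  suff : Q f by []; apply: Jf; split; last first.
    move=> g /= ggs m mg; exists m; first by apply/flatten_mapP; exists g.
    by exists 0%MM; rewrite ?addm0 // rmon0.
  split=> [m|x y Qx Qy m|a x Qx m].
  - by rewrite rees_val0 mem_psupp pcoef0 eqxx.
  - have [mx _|mx] := boolP (m \in psupp (rees_val x)); first exact: Qx.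
    rewrite mem_psupp rees_valD pcoefD; move: mx; rewrite mem_psupp negbK => /eqP ->.
    by rewrite add0r -mem_psupp; apply: Qy.
  - rewrite rees_valM => /psuppM[b [c [ba /Qx[d dL [e Se ->]]] ->]].
    exists d => //; exists (b + e)%MM; first by rewrite rmonD // (psupp_rees ba).
    by rewrite addmA (addmC b) -addmA.
exists (size L), (tnth (in_tuple L)) => [i|m].
  by have [] := LP _ (mem_tnth i (in_tuple L)).
have [k] := ubnP (mdeg m); elim: k m => // k IH m mk Sm.
have [->|m0] := eqVneq m 0%MM.
  exists (fun=> 0%N); rewrite big1 // => i _; exact: mulm0n.
have [||a aL [b Sb mab]] := Jdec (rmonom m) m.
- by rewrite /J /= -[rees_val _]/(rees_val _) val_rmonom // pcoef_monom (negPf m0).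
- by rewrite val_rmonom // mem_psupp pcoef_monom eqxx oner_eq0.
have [Sa a0] := LP _ aL.
have [|w bE] := IH b _ Sb.
  by move: mk; rewrite mab mdegD; move: a0; rewrite -mdeg_eq0; lia.
have /tnthP[i0 ai0] : a \in in_tuple L by [].
exists (fun i => (i == i0) + w i)%N; rewrite mab bE.
rewrite [RHS](eq_bigr (fun i =>
  (tnth (in_tuple L) i *+ (i == i0) + tnth (in_tuple L) i *+ w i)%MM)).
  rewrite big_split /= [X in _ = (X + _)%MM](bigD1 i0) //= eqxx mulm1n -ai0.
  rewrite [X in _ = (_ + X + _)%MM]big1 ?addm0 // => i /negPf ->; exact: mulm0n.
by move=> i _; apply/mnmP => j; rewrite !(mnmDE, mulmnE) mulnDr.
Qed.

End Rees.

(** * Faces of the monoid *)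

Section ExponentVectors.
Variables (F : numFieldType) (N : nat).
Implicit Types m s : 'X_{1..N}.

Definition mvec m : 'rV[F]_N := \row_i (m i)%:R.

Lemma mvecD m s : mvec (m + s)%MM = mvec m + mvec s.
Proof. by apply/rowP => i; rewrite !mxE mnmDE natrD. Qed.

Lemma mvec0 : mvec 0%MM = 0.
Proof. by apply/rowP => i; rewrite !mxE mnm0E. Qed.

Lemma mvecMn m k : mvec (m *+ k)%MM = k%:R *: mvec m.
Proof. by apply/rowP => i; rewrite !mxE mulmnE mulnC natrM. Qed.

Lemma mvec_sum (I : Type) (r : seq I) (G : I -> 'X_{1..N}) (w : I -> nat) :
  mvec (\sum_(i <- r) G i *+ w i)%MM = \sum_(i <- r) (w i)%:R *: mvec (G i).
Proof.
rewrite (big_morph mvec mvecD mvec0); by apply: eq_bigr => i _; rewrite mvecMn.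
Qed.

Lemma mvec_inj : injective mvec.
Proof.
move=> m s /rowP E; apply/mnmP => i; have := E i; rewrite !mxE.
by move/eqP; rewrite eqr_nat => /eqP.
Qed.

End ExponentVectors.

Section Faces.
Variables (K : fieldType) (n : nat) (I : graded_family K n).
Hypothesis I_monomial : forall k : nat, (0 < k)%N -> monomial_ideal (I k).
Implicit Types (m s : 'X_{1..n.+1}) (T : pred 'X_{1..n.+1}) (f : rees I).
Variables (q : nat) (G : 'I_q -> 'X_{1..n.+1}).
Hypothesis G_rmon : forall i, rmon I (G i).
Hypothesis G_gen : forall m, rmon I m ->
  exists w : 'I_q -> nat, m = (\sum_i G i *+ w i)%MM.

Local Notation fiber := {ideal_quot @in_rees_max K n I}.

(* The last condition makes the span of the monomials outside T contain the
   extension of the irrelevant ideal. *)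
Definition monoid_face T : Prop :=
  [/\ T 0%MM, forall m s, rmon I m -> rmon I s -> T (m + s)%MM = T m && T s
    & forall m, mhead m = 0%N -> m != 0%MM -> ~~ T m].

(** Its row space is the rational span of the face, so its rank is the rank of [T]; the generators
    outside [T] are replaced by zero rows to keep the index type fixed. *)
Definition face_mx T : 'M[rat]_(q, n.+1) :=
  \matrix_i (if T (G i) then mvec rat (G i) else 0).

Lemma face_sum T (w : 'I_q -> nat) : monoid_face T ->
  T (\sum_i G i *+ w i)%MM = [forall i, (0 < w i)%N ==> T (G i)].
Proof.
case=> T0 TD _.
have TMn i k : T (G i *+ k)%MM = (0 < k)%N ==> T (G i).
  elim: k => [|k IH]; first by rewrite mulm0n T0.
  rewrite mulmS TD ?IH ?G_rmon ?rmonMn //.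
  by case: (T (G i)) => //=; case: k {IH}.
suff H (r : seq 'I_q) : T (\sum_(i <- r) G i *+ w i)%MM =
    all (fun i => (0 < w i)%N ==> T (G i)) r.
  by rewrite H; apply/allP/forallP => [H' i|H' i _]; apply: H'; rewrite ?mem_index_enum.
elim: r => [|i r IH]; first by rewrite big_nil T0.
by rewrite big_cons TD ?TMn ?IH // ?rmonMn // rmon_sum.
Qed.

Lemma mvec_face T m : monoid_face T -> rmon I m -> T m ->
  (mvec rat m <= face_mx T)%MS.
Proof.
move=> Tface /G_gen[w ->]; rewrite face_sum // => /forallP Tw.
rewrite mvec_sum summx_sub // => i _; have [->|w0] := posnP (w i).
  by rewrite scale0r sub0mx.
rewrite scalemx_sub //; have -> : mvec rat (G i) = row i (face_mx T).
  by rewrite rowK; have := Tw i; rewrite w0 /= => ->.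
exact: row_sub.
Qed.

Section FaceMorphism.
Variables (T : pred 'X_{1..n.+1}) (r : nat) (e : 'I_r -> 'I_n.+1).
Hypothesis Tface : monoid_face T.

(* Coordinates e 0, ..., e (a - 1), padded with zeros. *)
Definition coords (a : nat) m : 'X_{1..r} :=
  [multinom if (i < a)%N then m (e i) else 0%N | i < r].

(** Monomials outside [T] are killed; in the others only the first [a] selected coordinates survive,
    the remaining variables being set to 1. *)
Definition face_monom a m : {mpoly K[r]} := if T m then 'X_[coords a m] else 0.

Lemma face_monom0 a : face_monom a 0%MM = 1.
Proof.
rewrite /face_monom; have [-> _ _] := Tface.
suff -> : coords a 0%MM = 0%MM by rewrite mpolyX0.
by apply/mnmP => i; rewrite !mnmE; case: ifP.
Qed.

Lemma face_monomD a m s : rmon I m -> rmon I s ->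
  face_monom a (m + s)%MM = face_monom a m * face_monom a s.
Proof.
move=> Sm Ss; rewrite /face_monom; have [_ -> // _] := Tface.
case: (T m) (T s) => [] [] /=; rewrite ?mulr0 ?mul0r //.
rewrite -mpolyXD; congr 'X_[_]; apply/mnmP => i; rewrite !mnmE.
by case: ifP.
Qed.

Lemma face_monom_max a m : mhead m = 0%N -> m != 0%MM -> face_monom a m = 0.
Proof.
by move=> h0 m0; rewrite /face_monom; have [_ _ /(_ _ h0 m0)/negPf ->] := Tface.
Qed.

(** The map for [a] is the map for [b] followed by setting the variables of index at least [a] to 1,
    so the kernels grow as [a] decreases. *)
Lemma face_lext_mono a b (f : {poly {mpoly K[n]}}) : (a <= b)%N ->
  lext (face_monom b) f = 0 -> lext (face_monom a) f = 0.
Proof.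
move=> ab fb; pose lq := [tuple if (i < a)%N then 'X_i else 1 : {mpoly K[r]} | i < r].
suff -> : lext (face_monom a) f = lext (face_monom b) f \mPo lq.
  by rewrite fb comp_mpoly0.
rewrite /lext raddf_sum; apply: eq_bigr => m _; rewrite /= comp_mpolyZ; congr (_ *: _).
rewrite /face_monom; case: (T m); last by rewrite comp_mpoly0.
rewrite comp_mpolyX mpolyXE_id; apply: eq_bigr => i _; rewrite tnth_mktuple !mnmE.
by case: ifP => ia; rewrite ?expr1n ?expr0 // (leq_trans ia ab).
Qed.

End FaceMorphism.

(** The primes are the kernels of the maps that keep [r], [r - 1], ..., 0 of the coordinates [e],
    which are independent on the span of [T]. A difference of two monomials of [T] shows that the
    inclusions are strict. *)
Lemma face_prime_chain T : monoid_face T ->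
  exists P : 'I_(\rank (face_mx T)).+1 -> prime_idealr fiber, prime_chain P.
Proof.
move=> Tface; rewrite -mxrank_tr; set A := (face_mx T)^T; set r : nat := \rank A.
pose e := maxrankfun A; pose u a := face_monom T e a.
have uP a : exists P : prime_idealr fiber,
    forall f, (\pi_fiber%qT f \in P) = (lext (u a) f == 0).
  have u0 := face_monom0 e Tface a; have uD := face_monomD e Tface a.
  have [phi phiE] := rees_morphism I_monomial u0 uD.
  have [|P PE] := @quot_kernel_prime _ (@in_rees_max K n I) _ phi.
    move=> f fmax; rewrite phiE; apply: lext_rees_max fmax => //.
    exact: face_monom_max.
  by exists P => f; rewrite PE phiE.
have [P PE] := choice uP.
exists (fun i => P (r - i)%N) => i j ij; have jr := ltn_ord j; split=> [x|].
  rewrite /= -[x]reprK !PE => /eqP H; apply/eqP.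
  by apply: face_lext_mono H; lia.
set b := (r - i)%N; have ar : (r - j < r)%N by lia.
pose a : 'I_r := Ordinal ar.
have full : row_full (colsub e (face_mx T)).
  have -> : colsub e (face_mx T) = (rowsub e A)^T by apply/matrixP => x y; rewrite !mxE.
  by rewrite /row_full mxrank_tr eq_maxrowsub.
(* Some rational combination of the generators in [T] has coordinate 1 at [e a] and 0 at the other
   selected places. Cleared of denominators, it yields two elements of [T] that differ at [e a]
   alone among these places. *)
have /submxP[v vE] : ((delta_mx 0 a : 'rV[rat]_r) <= colsub e (face_mx T))%MS.
  exact: submx_full.
have [N [zp [zm [N0 zE _ _]]]] := clear_denominators (v 0).
pose mk (z : 'I_q -> nat) := (\sum_i G i *+ (if T (G i) then z i else 0%N))%MM.
have mkT z : T (mk z).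
  by rewrite face_sum //; apply/forallP => k; case: (T (G k)); rewrite ?implybT.
have mkS z : rmon I (mk z) by exact: rmon_sum.
have mkE k : ((mk zp) (e k))%:R - ((mk zm) (e k))%:R = N%:R * (a == k)%:R :> rat.
  have vk := congr1 (fun M : 'rV_r => M 0 k) vE; rewrite !mxE eqxx /= in vk.
  rewrite [k == a]eq_sym in vk.
  rewrite vk mulr_sumr.
  have mvk z : ((mk z) (e k))%:R = (mvec rat (mk z)) 0 (e k) by rewrite mxE.
  rewrite !mvk !mvec_sum !summxE -sumrB; apply: eq_bigr => x _; rewrite !mxE.
  case: (T (G x)); last by rewrite mxE !mul0r !mulr0 subrr.
  by rewrite mxE -mulrBl -zE mulrA.
move=> /(_ (\pi_fiber%qT (rmonom I (mk zp) - rmonom I (mk zm)))) /=.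
rewrite !PE rees_valB !val_rmonom // !lextD !lextN !lext_monom /u /face_monom !mkT.
have -> : coords e (r - j) (mk zp) = coords e (r - j) (mk zm).
  apply/mnmP => k; rewrite !mnmE; case: ifP => // kj.
  have := mkE k; case: eqP => [ak|_]; first by rewrite -ak /= ltnn in kj.
  by rewrite mulr0 => /eqP; rewrite subr_eq0 eqr_nat => /eqP.
rewrite subrr eqxx => /(_ isT); rewrite subr_eq0 => /eqP.
move=> /(congr1 (fun p => p@_(coords e b (mk zm)))).
rewrite !mcoeffX eqxx; case: eqP => [|_ /eqP]; last by rewrite eq_sym oner_eq0.
move=> /mnmP/(_ a); rewrite !mnmE /= /b.
have -> : (r - j < r - i)%N by lia.
move=> E _; have := mkE a; rewrite E eqxx mulr1 subrr => /eqP.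
by rewrite eq_sym pnatr_eq0; lia.
Qed.

(** The difference of the two vectors lies in the row space of [face_mx T], where the selected
    coordinates determine a vector. The bound [n.+1] exceeds every index, so [coords] truncates
    nothing. *)
Lemma coords_inj T (e : 'I_(\rank (face_mx T)^T) -> 'I_n.+1) m s :
  monoid_face T -> (forall v : 'rV[rat]_q, v *m colsub e (face_mx T) = 0 ->
    v *m face_mx T = 0) ->
  rmon I m -> rmon I s -> T m -> T s ->
  coords e n.+1 m = coords e n.+1 s -> m = s.
Proof.
move=> Tface eP Sm Ss Tm Ts ms; apply: (@mvec_inj rat); apply/eqP.
have /submxP[v vE] : (mvec rat m - mvec rat s <= face_mx T)%MS.
  by rewrite addmx_sub ?eqmx_opp ?mvec_face.
rewrite -subr_eq0 vE; apply/eqP/eP.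
have -> : colsub e (face_mx T) = face_mx T *m colsub e 1%:M.
  by rewrite mulmx_colsub mulmx1.
rewrite mulmxA -vE mulmx_colsub mulmx1; apply/rowP => k.
have := congr1 (fun p : 'X_{1..\rank (face_mx T)^T} => p k) ms; rewrite /coords !mnmE.
have kn : (k < n.+1)%N := leq_trans (ltn_ord k) (rank_leq_row _).
by rewrite kn => mk; rewrite !mxE mk subrr.
Qed.

(** If [m] exceeded the rank, the images under [phi] of elements picked along the chain would be
    dependent in a polynomial ring with too few variables; the relation would hold modulo [P ord0],
    against [prime_chain_independent]. *)
Lemma prime_chain_bound (m : nat) (P : 'I_m.+1 -> prime_idealr fiber) : prime_chain P ->
  exists2 T, monoid_face T & (m <= \rank (face_mx T))%N.
Proof.
move=> Pchain; pose T x := rmon I x && (\pi_fiber%qT (rmonom I x) \notin P ord0).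
have Tface : monoid_face T.
  split=> [|x y Sx Sy|x h0 x0]; rewrite /T.
  - by rewrite rmon0 rmonom0 rmorph1 idealr1.
  - by rewrite rmonD // Sx Sy rmonomD // rmorphM prime_idealrM negb_or.
  rewrite negb_and negbK; apply/orP; right.
  have [i xi] := mtail_neq0 h0 x0.
  (* A variable is split off from the monomial; it vanishes in the fiber ring. *)
  have xE : x = (mcons 0 U_(i) + mcons 0 (mtail x - U_(i)))%MM.
    rewrite -{1}(mcons_eta x) h0; apply/mnmP => j; rewrite !mnmE.
    case: unliftP => //= k _; rewrite mnmBE mnm1E.
    case: eqP => [<-|_]; last by rewrite subn0.
    by rewrite subnKC // lt0n.
  rewrite xE rmonomD ?rmon_mhead0 ?mhead_cons // rmorphM prime_idealrM /=.
  suff -> : \pi_fiber%qT (rmonom I (mcons 0 U_(i))) = 0 by rewrite /= rpred0.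
  rewrite -(rmorph0 \pi_fiber%qT); apply/eqP; rewrite -Quotient.idealrBE subr0.
  exact: rmonom_in_rees_max.
exists T => //; rewrite leqNgt; apply/negP.
rewrite -mxrank_tr; set A := (face_mx T)^T => rm.
pose e := maxrankfun A.
have [phi phiE] := rees_morphism I_monomial
  (face_monom0 e Tface _) (face_monomD e Tface n.+1).
have inj x y : rmon I x -> rmon I y -> T x -> T y ->
    coords e n.+1 x = coords e n.+1 y -> x = y.
  apply: coords_inj => // v vE; apply/eqP; rewrite -trmx_eq0 trmx_mul.
  have /submxP[B BE] : (A <= rowsub e A)%MS by rewrite eq_maxrowsub.
  rewrite -/A BE -mulmxA; have -> : rowsub e A *m v^T = (v *m colsub e (face_mx T))^T.
    by rewrite trmx_mul; congr (_ *m _); apply/matrixP => x0 y0; rewrite !mxE.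
  by rewrite vE trmx0 mulmx0.
(* Distinct elements of [T] go to distinct monomials, so an element of the kernel has no term in
   [T]; its other terms lie in [P ord0] by the choice of [T]. *)
have phi0 f : phi f = 0 -> \pi_fiber%qT f \in P ord0.
  rewrite phiE => f0; rewrite (rees_monomE I_monomial f) rmorph_sum.
  rewrite big_seq; apply: rpred_sum => s sf; rewrite rmorphM.
  have Ss := psupp_rees I_monomial sf.
  have [Ts|] := boolP (T s); last first.
    by rewrite /T Ss /= negbK; apply: idealMr.
  suff -> : pcoef (rees_val f) s = 0 by rewrite !rmorph0 mul0r rpred0.
  have := congr1 (fun p => p@_(coords e n.+1 s)) f0; rewrite mcoeff0 /lext raddf_sum /=.
  rewrite (bigD1_seq s) ?psupp_uniq //= big_seq_cond big1 ?addr0.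
    by rewrite mcoeffZ /face_monom Ts mcoeffX eqxx mulr1.
  move=> x /andP[xf xs]; rewrite mcoeffZ /face_monom; case: ifP => Tx; last first.
    by rewrite mcoeff0 mulr0.
    rewrite mcoeffX; case: eqP => [/inj xE|]; rewrite ?mulr0 //.
    by rewrite xE ?eqxx // in xs; apply: psupp_rees xf.
have Psub i : (i < m)%N ->
    [set x | x \in P (inord i)] `<` [set x | x \in P (inord i.+1)].
  by move=> im; apply: Pchain; rewrite !inordK //; lia.
have ex i : exists f : rees I, (i < m)%N ->
   \pi_fiber%qT f \notin P (inord i) /\ \pi_fiber%qT f \in P (inord i.+1).
  have [im|] := ltnP i m; last by exists 0.
  have [_ /existsNP[x /not_implyP[x1 x2]]] := Psub _ im.
  by exists (repr x) => _; rewrite reprK; split=> //; apply/negP.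
have [g gP] := choice ex.
have [D [c [x0 cx0 c0]]] := mpoly_dependent (fun i => phi (g i)) rm.
pose kap : {rmorphism K -> fiber} := \pi_fiber%qT \o @rees_const K n I.
pose ee (x : {ffun 'I_m -> 'I_D}) (i : nat) := oapp (fun j => x j : nat) 0%N (insub i).
have eeE x (i : 'I_m) : ee x i = x i by rewrite /ee valK.
suff /eqP : c x0 = 0 by rewrite (negPf cx0).
apply: (@prime_chain_independent _ _ kap m (fun i => P (inord i))
  (fun i => \pi_fiber%qT (g i)) _ _ _ _ predT ee c) => //.
- by move=> i /Psub[].
- by move=> i /gP[].
- by move=> i /gP[].
- move=> x y _ _ xy; apply/ffunP => i; apply/val_inj.
  by have := xy i (ltn_ord i); rewrite !eeE.
have -> : inord 0 = ord0 :> 'I_m.+1 by apply/val_inj; rewrite /= inordK.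
have -> : \sum_x kap (c x) * \prod_(i < m) \pi_fiber%qT (g i) ^+ ee x i =
  \pi_fiber%qT (\sum_x rees_const I (c x) * \prod_(i < m) g i ^+ x i).
  rewrite rmorph_sum; apply: eq_bigr => x _; rewrite rmorphM rmorph_prod.
  by congr (_ * _); apply: eq_bigr => i _; rewrite rmorphXn eeE.
apply: phi0; rewrite rmorph_sum -[RHS]c0; apply: eq_bigr => x _.
rewrite rmorphM phiE lext_rees_const ?face_monom0 // mul_mpolyC rmorph_prod.
by congr (_ *: _); apply: eq_bigr => i _; rewrite rmorphXn.
Qed.

(** In the other case of Motzkin's alternative, a relation gives two equal sums of generators. One
    involves only generators in [T], the other also a generator outside [T], which contradicts the
    face property. *)
Lemma face_functional T : monoid_face T -> exists psi : 'cV[rat]_n.+1,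
  forall i, if T (G i) then (mvec rat (G i) *m psi) 0 0 = 0
            else 0 < (mvec rat (G i) *m psi) 0 0.
Proof.
move=> Tface; pose W := \matrix_i mvec rat (G i).
have rowW i : row i W = mvec rat (G i) by rewrite rowK.
have [[y Hy]|[v [vW v0 [i0 Ti0 vi0]]]] := motzkin W (fun i => T (G i)).
  by exists y => i; have := Hy i; rewrite -rowW -row_mul !mxE.
have [N [zp [zm [N0 zE zm0 zp0]]]] := clear_denominators (v 0).
have E : (\sum_i G i *+ zp i = \sum_i G i *+ zm i)%MM.
  apply: (@mvec_inj rat); rewrite !mvec_sum; apply/eqP; rewrite -subr_eq0 -sumrB.
  rewrite (eq_bigr (fun i => N%:R *: (v 0 i *: row i W))) => [|i _].
    by rewrite -scaler_sumr -mulmx_sum_row vW scaler0.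
  by rewrite rowW -scalerBl -zE scalerA.
have : T (\sum_i G i *+ zm i)%MM.
  rewrite face_sum //; apply/forallP => i.
  case: (boolP (T (G i))) => Ti; rewrite ?implybT //.
  by rewrite zm0 ?v0.
rewrite -E face_sum // => /forallP/(_ i0).
by rewrite (negPf Ti0) zp0.
Qed.

End Faces.

(** * Faces of the Newton-Okounkov body *)

Lemma continuous_linear_comb (R : realType) (X : topologicalType) (J : Type)
    (r : seq J) (a : J -> R) (f : J -> X -> R) :
  (forall i, continuous (f i)) -> continuous (fun x => \sum_(i <- r) a i * f i x).
Proof.
move=> fc; elim: r => [|i r IH] x.
  rewrite (_ : (fun _ => _) = (fun=> 0)); first exact: cst_continuous.
  by apply/funext => y; rewrite big_nil.
rewrite (_ : (fun _ => _) = (fun y => a i * f i y + \sum_(i <- r) a i * f i y)).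
  apply: cvgD; last exact: IH.
  by apply: cvgM; [exact: cst_continuous|exact: fc].
by apply/funext => y; rewrite big_cons.
Qed.

Lemma translation_continuous (R : realType) (V : normedModType R) (v : V) :
  continuous (fun x => x + v).
Proof. by move=> x; apply: cvgD; [exact: cvg_id|exact: cst_continuous]. Qed.

Section LinearForms.
Variables (R : realType) (n : nat).
Implicit Types (c : 'rV[R]_n) (x : 'rV[R]_n).

Lemma linear_form_continuous c :
  continuous (fun x : 'rV[R]_n => \sum_i c 0 i * x 0 i).
Proof. by apply: continuous_linear_comb => i; exact: coord_continuous. Qed.

Lemma closed_halfspace c (b : R) :
  closed [set x : 'rV[R]_n | b <= \sum_i c 0 i * x 0 i].
Proof.
apply: (@closed_comp _ _ (fun x : 'rV[R]_n => \sum_i c 0 i * x 0 i) [set y | b <= y]).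
  by move=> x _; exact: linear_form_continuous.
exact: closed_ge.
Qed.

Lemma closed_hyperplane c (b : R) :
  closed [set x : 'rV[R]_n | \sum_i c 0 i * x 0 i = b].
Proof.
apply: (@closed_comp _ _ (fun x : 'rV[R]_n => \sum_i c 0 i * x 0 i) [set y | y = b]).
  by move=> x _; exact: linear_form_continuous.
exact: closed_eq.
Qed.

End LinearForms.

Section Polyhedron.
Variables (K : fieldType) (n : nat) (R : realType) (I : graded_family K n).
Implicit Types (m s : 'X_{1..n.+1}) (T : pred 'X_{1..n.+1}) (c x : 'rV[R]_n).

Local Notation Delta := (newton_okounkov I R).

Definition tailv m : 'rV[R]_n := \row_i (mtail m i)%:R.
Definition npoint m : 'rV[R]_n := (mhead m)%:R^-1 *: tailv m.
Definition weight c (b : R) m : R := \sum_i c 0 i * tailv m 0 i - b * (mhead m)%:R.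

Lemma weightD c b m s : weight c b (m + s)%MM = weight c b m + weight c b s.
Proof.
rewrite /weight mheadD natrD mulrDr opprD addrACA -big_split /=; congr (_ + _).
by apply: eq_bigr => i _; rewrite !mxE mtailD mnmDE natrD mulrDr.
Qed.

Lemma weight0 c b : weight c b 0%MM = 0.
Proof.
rewrite /weight mhead0 mulr0 subr0 big1 // => i _.
by rewrite mxE mtail0 mnm0E mulr0.
Qed.

Lemma weightMn c b m k : weight c b (m *+ k)%MM = weight c b m *+ k.
Proof.
elim: k => [|k IH]; first by rewrite mulm0n weight0.
by rewrite mulmS weightD IH mulrS.
Qed.

Lemma weight_sum c b (J : Type) (r : seq J) (G : J -> 'X_{1..n.+1}) w :
  weight c b (\sum_(i <- r) G i *+ w i)%MM = \sum_(i <- r) weight c b (G i) *+ w i.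
Proof.
rewrite (big_morph (weight c b) (weightD c b) (weight0 c b)).
by apply: eq_bigr => i _; rewrite weightMn.
Qed.

Lemma weight_npoint c b m : (0 < mhead m)%N ->
  \sum_i c 0 i * npoint m 0 i = b + (mhead m)%:R^-1 * weight c b m.
Proof.
move=> m0; have mN0 : (mhead m)%:R != 0 :> R by rewrite pnatr_eq0 -lt0n.
rewrite /weight mulrBr mulrCA mulVf // mulr1 addrC subrK mulr_sumr.
by apply: eq_bigr => i _; rewrite [npoint m 0 i]mxE mulrCA.
Qed.

Lemma npoint_Delta m : rmon I m -> (0 < mhead m)%N -> Delta (npoint m).
Proof.
move=> /asboolP Im m0; apply: subset_closure; exists (mhead m), (mtail m).
by split=> //; rewrite /npoint; congr (_ *: _).
Qed.

Lemma Delta_sub (A : set 'rV[R]_n) : closed A ->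
  (forall m, rmon I m -> (0 < mhead m)%N -> A (npoint m)) -> Delta `<=` A.
Proof.
move=> /closure_id Acl H; rewrite Acl; apply: closure_subset => _ [k [a [k0 Ia ->]]].
have := H (mcons k a); rewrite /npoint /tailv mhead_cons mtail_cons; apply => //.
by apply/asboolP; rewrite mhead_cons mtail_cons.
Qed.

Lemma Delta_ge c b : (forall m, rmon I m -> 0 <= weight c b m) ->
  forall x, Delta x -> b <= \sum_i c 0 i * x 0 i.
Proof.
move=> H; apply: Delta_sub; first exact: closed_halfspace.
by move=> m Sm m0; rewrite /= (weight_npoint c b m0) lerDl mulr_ge0 ?H.
Qed.

(** Multiplying a monomial of the ideal of index [k] by the power [j * k] of [x_i] moves its point
    by [j] in direction [i]; continuity extends this to the closure. *)
Lemma Delta_translate x i (j : nat) : Delta x -> Delta (x + j%:R *: delta_mx 0 i).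
Proof.
move: x; pose t (x : 'rV[R]_n) := x + j%:R *: delta_mx 0 i.
suff : Delta `<=` t @^-1` Delta by [].
apply: Delta_sub.
  apply: closed_comp; last exact: closed_closure.
  by by move=> x _; exact: translation_continuous.
move=> m Sm m0; have mN0 : (mhead m)%:R != 0 :> R by rewrite pnatr_eq0 -lt0n.
rewrite /preimage /mkset /t; pose s := (m + mcons 0 (U_(i) *+ (j * mhead m)))%MM.
have hs : mhead s = mhead m by rewrite mheadD mhead_cons addn0.
have -> : npoint m + j%:R *: delta_mx 0 i = npoint s.
  apply/rowP => k; rewrite /npoint /tailv hs mtailD mtail_cons !mxE mnmDE natrD mulrDr.
  congr (_ + _); rewrite mulmnE mnm1E !natrM eq_sym /=.
  by field.
apply: npoint_Delta; last by rewrite hs.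
by apply: rmonD => //; apply: rmon_mhead0; rewrite mhead_cons.
Qed.

(** The translate of [x0] by 1 in direction [i] stays in the body, so [c 0 i] is nonnegative. If it
    were zero, all integer translates would stay in the face, which would be unbounded. *)
Lemma compact_face_pos c b x0 : (forall x, Delta x -> b <= \sum_i c 0 i * x 0 i) ->
  Delta x0 -> \sum_i c 0 i * x0 0 i = b ->
  compact [set x | Delta x /\ \sum_i c 0 i * x 0 i = b] -> forall i, 0 < c 0 i.
Proof.
move=> cb Dx0 x0b Fcpt i.
have shift j : \sum_k c 0 k * (x0 + j%:R *: delta_mx 0 i) 0 k = b + j%:R * c 0 i.
  rewrite -x0b (bigD1 i) //= [in RHS](bigD1 i) //= !mxE !eqxx mulr1 mulrDr.
  rewrite addrAC -addrA [c 0 i * j%:R]mulrC !addrA; congr (_ + _ + _).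
  by apply: eq_bigr => k /negPf ki; rewrite !mxE ki andbF mulr0 addr0.
have ci0 : 0 <= c 0 i.
  have := cb _ (@Delta_translate x0 i 1 Dx0); rewrite shift mul1r lerDl; exact.
rewrite lt_def ci0 andbT; apply/negP => /eqP ci.
have : bounded_set [set x 0 i | x in [set x | Delta x /\ \sum_i c 0 i * x 0 i = b]].
  apply: compact_bounded; apply: continuous_compact => //.
  by apply: continuous_subspaceT => x; exact: coord_continuous.
case/pinfty_ex_gt0 => M M0 /= HM.
pose j := (Num.trunc (M + `|x0 0 i|)).+1.
suff /HM : [set x 0 i | x in [set x | Delta x /\ \sum_i c 0 i * x 0 i = b]]
    ((x0 + j%:R *: delta_mx 0 i) 0 i).
  apply/negP; rewrite -ltNge !mxE !eqxx mulr1.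
  have : M + `|x0 0 i| < j%:R by rewrite truncnS_gt.
  have := ler_norm (x0 0 i + j%:R); have := ler_norm (- x0 0 i); rewrite normrN; lra.
exists (x0 + j%:R *: delta_mx 0 i) => //; split; first exact: Delta_translate.
by rewrite shift ci mulr0 addr0.
Qed.

Definition affine_number (F : set 'rV[R]_n) : nat :=
  \max_(m < n.+2 | `[< exists X : 'M[R]_(m, n),
      (forall i, F (row i X)) /\ affinely_independent X >]) m.

Lemma aff_dimE F : aff_dim F = (affine_number F)%:Z - 1.
Proof. by []. Qed.

Hypothesis I_monomial : forall k : nat, (0 < k)%N -> monomial_ideal (I k).
Variables (q : nat) (G : 'I_q -> 'X_{1..n.+1}).
Hypothesis G_rmon : forall i, rmon I (G i).
Hypothesis G_gen : forall m, rmon I m ->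
  exists w : 'I_q -> nat, m = (\sum_i G i *+ w i)%MM.

(** The point is placed at height 1, so that affine independence becomes linear independence. *)
Definition homogenize x : 'rV[R]_n.+1 := \row_j oapp (x 0) 1 (unlift ord0 j).

Lemma homogenizeE x (g : 'cV[R]_n.+1) :
  (homogenize x *m g) 0 0 = g ord0 0 + \sum_i g (lift ord0 i) 0 * x 0 i.
Proof.
rewrite mxE big_ord_recl mxE unlift_none /= mul1r; congr (_ + _).
by apply: eq_bigr => i _; rewrite mxE liftK /= mulrC.
Qed.

Lemma weight_mvec c b m :
  weight c b m = (mvec R m *m (\col_j oapp (c 0) (- b) (unlift ord0 j))) 0 0.
Proof.
rewrite /weight mxE big_ord_recl !mxE unlift_none /= addrC mulrN [_ * b]mulrC.
by congr (_ + _); apply: eq_bigr => i _; rewrite !mxE liftK mnmE mulrC.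
Qed.

Lemma weight_monoid_face c b : (forall i, 0 < c 0 i) ->
  (forall m, rmon I m -> 0 <= weight c b m) ->
  monoid_face I (fun m => rmon I m && (weight c b m == 0)).
Proof.
move=> c0 w0; split=> [|m s Sm Ss|m h0 m0].
- by rewrite rmon0 weight0 eqxx.
- by rewrite rmonD // Sm Ss weightD paddr_eq0 ?w0.
- rewrite negb_and; apply/orP; right; rewrite /weight h0 mulr0 subr0.
  have [i xi] := mtail_neq0 h0 m0.
  rewrite gt_eqF // (bigD1 i) //= ltr_pwDl //.
    by rewrite mulr_gt0 // mxE ltr0n lt0n.
  by rewrite sumr_ge0 // => k _; rewrite mulr_ge0 ?(ltW (c0 k)) // mxE ler0n.
Qed.

(* A linear form vanishing on the generators in the face is dominated by a
   multiple of the weight; this inequality passes to the closure. *)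
Lemma homogenize_face c b x (T := fun m => rmon I m && (weight c b m == 0)) :
  (forall m, rmon I m -> 0 <= weight c b m) ->
  Delta x -> \sum_i c 0 i * x 0 i = b ->
  (homogenize x <= map_mx ratr (face_mx G T))%MS.
Proof.
move=> w0 Dx xb; set W := map_mx _ _; rewrite submxE; apply/eqP/rowP => j.
rewrite [RHS]mxE; pose g := col j (cokermx W).
have -> : (homogenize x *m cokermx W) 0 j = (homogenize x *m g) 0 0.
  by rewrite /g colE (mulmxA (homogenize x) (cokermx W)) -colE [RHS]mxE.
pose h m := (mvec R m *m g) 0 0.
have hT i : weight c b (G i) = 0 -> h (G i) = 0.
  move=> wi; rewrite /h; have -> : mvec R (G i) = row i W.
    by apply/rowP => k; rewrite !mxE /T G_rmon wi eqxx /= mxE ratr_nat.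
  by rewrite -row_mul /g colE (mulmxA W (cokermx W)) mulmx_coker mul0mx row0 mxE.
have hsum (w : 'I_q -> nat) : h (\sum_i G i *+ w i)%MM = \sum_i h (G i) *+ w i.
  rewrite /h mvec_sum mulmx_suml summxE; apply: eq_bigr => i _.
  by rewrite -scalemxAl mxE mulr_natl.
pose C := \sum_i `|h (G i)| / weight c b (G i).
have Ci i : `|h (G i)| <= C * weight c b (G i).
  have [wi|wi] := eqVneq (weight c b (G i)) 0.
    by rewrite hT // normr0 wi mulr0.
  have wp : 0 < weight c b (G i) by rewrite lt_def wi w0.
  rewrite -ler_pdivrMr // /C (bigD1 i) //= lerDl sumr_ge0 // => k _.
  by rewrite divr_ge0 ?w0.
have Cm m : rmon I m -> `|h m| <= C * weight c b m.
  case/G_gen => w ->; rewrite hsum weight_sum mulr_sumr.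
  apply: le_trans (ler_norm_sum _ _ _) _; apply: ler_sum => i _.
  by rewrite normrMn mulrnAr lerMn2r Ci orbT.
have key (e : R) : `|e| = 1 -> 0 <= e * (homogenize x *m g) 0 0.
  move=> e1; pose c' := \row_i (C * c 0 i + e * g (lift ord0 i) 0).
  have := @Delta_ge c' (C * b - e * g ord0 0) _ x Dx.
  have -> : \sum_i c' 0 i * x 0 i =
      C * b + e * \sum_i g (lift ord0 i) 0 * x 0 i.
    rewrite -xb !mulr_sumr -big_split; apply: eq_bigr => i _ /=.
    by rewrite mxE mulrDl !mulrA.
  rewrite homogenizeE mulrDr => H; suff : 
    C * b - e * g ord0 0 <= C * b + e * \sum_i g (lift ord0 i) 0 * x 0 i by lra.
  apply: H => m Sm; have -> : weight c' (C * b - e * g ord0 0) m =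
      C * weight c b m + e * h m.
    rewrite /weight /h [(_ *m g) 0 0]mxE big_ord_recl !mxE -/(mhead m).
    have -> : \sum_i c' 0 i * tailv m 0 i = C * (\sum_i c 0 i * tailv m 0 i) +
        e * \sum_i mvec R m 0 (lift ord0 i) * g (lift ord0 i) 0.
      rewrite !mulr_sumr -big_split; apply: eq_bigr => i _ /=.
      rewrite [c' 0 i]mxE; move: (g _ _) => gi; rewrite !mxE mnmE; ring.
    ring.
  have := Cm m Sm; have := ler_norm (- (e * h m)).
  by rewrite normrN normrM e1 mul1r; lra.
have := key 1 (normr1 _); have := key (-1) _; rewrite normrN1 => /(_ erefl).
by rewrite mulN1r mul1r oppr_ge0 => h1 h2; apply/eqP; rewrite eq_le h1.
Qed.

(** The zeros of the weight form a face of the monoid. Affinely independent points of [F] give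
    independent real vectors in its span, whose rank does not change from [rat] to [R]. *)
Lemma affine_number_le F : is_face Delta F -> compact F ->
  exists2 T, monoid_face I T & (affine_number F <= \rank (face_mx G T))%N.
Proof.
move=> [c [b [cb FE]]] Fcpt; have [[x0 Fx0]|F0] := pselect (exists x, F x); last first.
  (* The empty face has affine number 0, so any face of the monoid will do. *)
  exists (pred1 0%MM); last first.
    apply/bigmax_leqP => m /asboolP[X [XF _]]; rewrite leqNgt; apply/negP => m0.
    by case: F0; exists (row (Ordinal m0) X).
  by split=> [|m s _ _|m _ m0] /=; rewrite ?mnmD_eq0.
rewrite FE in Fx0; have [Dx0 x0b] := Fx0; rewrite FE in Fcpt.
have c0 := compact_face_pos cb Dx0 x0b Fcpt.
have w0 m : rmon I m -> 0 <= weight c b m.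
  move=> Sm; have [h0|h0] := posnP (mhead m).
    rewrite /weight h0 mulr0 subr0 sumr_ge0 // => i _.
    by rewrite mulr_ge0 ?(ltW (c0 i)) // mxE ler0n.
  have := cb _ (npoint_Delta Sm h0); rewrite (weight_npoint c b h0) lerDl.
  by rewrite pmulr_rge0 // invr_gt0 ltr0n.
exists (fun m => rmon I m && (weight c b m == 0)); first exact: weight_monoid_face.
set T := (fun m => _); apply/bigmax_leqP => m /asboolP[X [XF Xind]].
rewrite -(mxrank_map (@ratr R)).
pose Y := \matrix_i homogenize (row i X).
have Yfree : row_free Y.
  rewrite -kermx_eq0; apply/eqP/row_matrixP => k; rewrite row0.
  set v := row k _; have vY : v *m Y = 0.
    by rewrite -row_mul mulmx_ker row0.
  have := Xind (fun i => v 0 i) _ _; move=> H; apply/rowP => i; rewrite [RHS]mxE.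
  apply: H.
    have := congr1 (fun u : 'rV_n.+1 => u 0 ord0) vY; rewrite !mxE => E.
    rewrite -[RHS]E; apply: eq_bigr => s _; by rewrite !mxE unlift_none mulr1.
  apply/rowP => l; rewrite summxE [RHS]mxE.
  have := congr1 (fun u : 'rV_n.+1 => u 0 (lift ord0 l)) vY; rewrite !mxE => E.
  by rewrite -[RHS]E; apply: eq_bigr => s _; rewrite !mxE liftK /= mxE.
move: Yfree; rewrite /row_free => /eqP <-; apply: mxrankS.
apply/row_subP => i; rewrite rowK; have := XF i; rewrite FE => -[Dr rb].
exact: homogenize_face.
Qed.

(** A functional vanishing exactly on [T] is read as a weight, which cuts out [F]; independent
    generators in [T] give affinely independent points of [F]. *)
Lemma rank_le_affine_number T : monoid_face I T ->
  exists F, [/\ is_face Delta F, compact F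
    & (\rank (face_mx G T) <= affine_number F)%N].
Proof.
move=> Tface; have [psi Hpsi] := face_functional G_rmon Tface.
pose p m := (mvec rat m *m psi) 0 0.
have pG i : 0 <= p (G i).
  by have := Hpsi i; rewrite -/(p _); case: ifP => _ => [->|/ltW].
have psum (w : 'I_q -> nat) : p (\sum_i G i *+ w i)%MM = \sum_i p (G i) *+ w i.
  rewrite /p mvec_sum mulmx_suml summxE; apply: eq_bigr => i _.
  by rewrite -scalemxAl mxE mulr_natl.
have p0 m : rmon I m -> 0 <= p m.
  by case/G_gen=> w ->; rewrite psum sumr_ge0 // => i _; rewrite mulrn_wge0.
have pT m : rmon I m -> (p m == 0) = T m.
  case/G_gen=> w ->; rewrite psum psumr_eq0 => [|i _]; last by rewrite mulrn_wge0.
  rewrite (face_sum G_rmon) //; apply/allP/forallP => H i.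
    have := H i (mem_index_enum i); rewrite /= mulrn_eq0 lt0n.
    by case: eqP => //= _; have := Hpsi i; case: ifP => // _ /gt_eqF ->.
  move=> _ /=; rewrite mulrn_eq0; have := H i; have := Hpsi i; rewrite lt0n -/(p _).
  by case: ifP => _; [move=> -> _; rewrite eqxx orbT|case: eqP].
pose c : 'rV[R]_n := \row_i ratr (psi (lift ord0 i) 0).
pose b : R := - ratr (psi ord0 0).
have wE m : weight c b m = ratr (p m).
  rewrite weight_mvec /p !mxE rmorph_sum; apply: eq_bigr => i _.
  rewrite !mxE rmorphM /= ratr_nat; congr (_ * _).
  by case: unliftP => [k|] -> /=; rewrite ?mxE ?opprK.
have w0 m : rmon I m -> 0 <= weight c b m by move=> Sm; rewrite wE ler0q p0.
have c0 i : 0 < c 0 i.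
  have hm : mhead (mcons 0 (U_(i) : 'X_{1..n})) = 0%N by rewrite mhead_cons.
  have Sm := rmon_mhead0 I hm.
  have -> : c 0 i = weight c b (mcons 0 U_(i)).
    rewrite /weight mhead_cons mulr0 subr0 (bigD1 i) //= big1 ?addr0 => [|k ki].
      by rewrite !mxE mtail_cons mnm1E eqxx mulr1.
    by rewrite !mxE mtail_cons mnm1E eq_sym (negPf ki) mulr0.
  rewrite lt_def w0 // andbT wE fmorph_eq0 pT //.
  have [_ _ H] := Tface; apply: H => //; apply/eqP => /(congr1 (@mtail n)).
  by rewrite mtail_cons mtail0 => /eqP; rewrite mnm1_eq0.
pose F := [set x | Delta x /\ \sum_i c 0 i * x 0 i = b].
have Dpos x i : Delta x -> 0 <= x 0 i.
  move=> Dx; have := @Delta_ge (delta_mx 0 i) 0 _ x Dx.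
  rewrite (bigD1 i) //= big1 ?addr0 => [|k ki].
    rewrite mxE !eqxx mul1r; apply=> m _; rewrite /weight mul0r subr0.
    by rewrite sumr_ge0 // => k _; rewrite !mxE mulr_ge0.
  by rewrite mxE (negPf ki) andbF mul0r.
exists F; split; first by exists c, b; split=> //; exact: Delta_ge.
  (* Points of the body have nonnegative coordinates and [c] is positive, so each term
     [c 0 i * x 0 i] is at most [b] on [F]. *)
  pose B := [set x : 'rV[R]_n | forall i, `[0, b / c 0 i]%classic (x 0 i)].
  have Bcpt : compact B.
    apply: (@rV_compact R n (fun i => `[0, b / c 0 i]%classic)) => i.
    exact: segment_compact.
  apply: subclosed_compact Bcpt _.
    by apply: closedI; [exact: closed_closure|exact: closed_hyperplane].
  move=> x [Dx xb] i /=; rewrite in_itv /= Dpos //= ler_pdivlMr // -xb.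
  rewrite (bigD1 i) //= mulrC lerDl sumr_ge0 // => k _.
  by rewrite mulr_ge0 ?(ltW (c0 k)) // Dpos.
set W := face_mx G T; pose e := maxrankfun W.
have efree : row_free (rowsub e W) by rewrite /e maxrowsub_free.
(* The selected rows are independent, hence nonzero, so they come from generators in [T]. *)
have Te i : T (G (e i)).
  apply: contraTT efree => /negPf Ti; rewrite -kermx_eq0; apply/negP => /eqP ker0.
  have /sub_kermxP : (delta_mx 0 i : 'rV[rat]_(\rank W)) *m rowsub e W = 0.
    by rewrite -rowE; apply/rowP => k; rewrite !mxE Ti mxE.
  rewrite ker0 submx0 => /eqP/rowP/(_ i); rewrite !mxE !eqxx => /eqP.
  by rewrite oner_eq0.
(* The only element of [T] of degree 0 in t is 0, which would give a zero row. *)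
have he i : (0 < mhead (G (e i)))%N.
  rewrite lt0n; apply/negP => /eqP h0; have [_ _ H] := Tface.
  have [G0|/(H _ h0)] := eqVneq (G (e i)) 0%MM; last by rewrite Te.
  suff : ~~ row_free (rowsub e W) by rewrite efree.
  rewrite -kermx_eq0; apply/negP => /eqP ker0.
  have /sub_kermxP : (delta_mx 0 i : 'rV[rat]_(\rank W)) *m rowsub e W = 0.
    by rewrite -rowE; apply/rowP => k; rewrite !mxE Te mxE G0 mnm0E.
  rewrite ker0 submx0 => /eqP/rowP/(_ i); rewrite !mxE !eqxx => /eqP.
  by rewrite oner_eq0.
have rn : (\rank W < n.+2)%N by rewrite ltnS rank_leq_col.
apply: (bigop.leq_bigmax_cond (Ordinal rn)).
apply/asboolP; exists (\matrix_i npoint (G (e i))); split=> [i|v v1 vX i].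
  rewrite rowK; split; first exact: npoint_Delta.
  rewrite (weight_npoint c b) // wE; have /eqP -> : p (G (e i)) == 0 by rewrite pT.
  by rewrite rmorph0 mulr0 addr0.
(* An affine relation [v] between the points [a / k] is a linear relation with coefficients [v / k]
   between the vectors [(k, a)]; the head coordinate expresses that [v] sums to 0. *)
pose z := \row_k (v k / (mhead (G (e k)))%:R).
have hN0 k : (mhead (G (e k)))%:R != 0 :> R by rewrite pnatr_eq0 -lt0n.
have : row_free (map_mx (@ratr R) (rowsub e W)) by rewrite row_free_map.
rewrite -kermx_eq0 => /eqP ker0.
have /sub_kermxP : z *m map_mx (@ratr R) (rowsub e W) = 0.
  apply/rowP => j; rewrite [RHS]mxE mxE; case: (unliftP ord0 j) => [k ->|->].
    have := congr1 (fun u : 'rV_n => u 0 k) vX; rewrite summxE mxE => E.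
    rewrite -[RHS]E; apply: eq_bigr => l _.
    by rewrite !mxE Te mxE ratr_nat mnmE mulrA.
  rewrite -[RHS]v1; apply: eq_bigr => l _.
  by rewrite !mxE Te mxE ratr_nat -/(mhead _) divfK.
rewrite ker0 submx0 => /eqP/rowP/(_ i); rewrite !mxE => /eqP.
by rewrite mulf_eq0 invr_eq0 (negPf (hN0 _)) orbF => /eqP.
Qed.

End Polyhedron.

(** * Equality of the analytic spread and the dimension of compact faces plus one *)

Local Open Scope ereal_scope.

Theorem theorem4p1 (K : fieldType) (n : nat) (R : realType)
    (I : graded_family K n)
    (I_monomial : forall k : nat, (0 < k)%N -> monomial_ideal (I k))
    (I_noetherian : noetherian_family I) :
  analytic_spread I R = mdc (newton_okounkov I R) + 1.
Proof.
have [q [G G_rmon G_gen]] := rees_finitely_generated I_monomial I_noetherian.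
apply/eqP; rewrite eq_le; apply/andP; split.
  apply: ge_ereal_sup => _ [m [P Pchain] <-].
  have [T Tface mT] := prime_chain_bound I_monomial G_rmon G_gen Pchain.
  have [F [Fface Fcpt TF]] := rank_le_affine_number R G_rmon G_gen Tface.
  apply: (@le_trans _ _ (((aff_dim F)%:~R)%:E + 1)); last first.
    by apply: leeD => //; apply: ereal_sup_ubound; exists F.
  (* The 1 subtracted in [aff_dim] cancels the added 1, which leaves a comparison of natural numbers
     through the rank of [T]. *)
  rewrite aff_dimE rmorphB /= -EFinD subrK lee_fin -pmulrn ler_nat.
  exact: leq_trans mT TF.
rewrite -leeBrDr //; apply: ge_ereal_sup => _ [F [Fface Fcpt] <-].
have [T Tface FT] := affine_number_le G_rmon G_gen Fface Fcpt.
have [P Pchain] := face_prime_chain I_monomial G_rmon Tface.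
rewrite leeBrDr // aff_dimE rmorphB /= -EFinD subrK -pmulrn.
apply: (@le_trans _ _ ((\rank (face_mx G T))%:R)%:E); first by rewrite lee_fin ler_nat.
by apply: ereal_sup_ubound; exists (\rank (face_mx G T)) => //; exists P.
Qed.
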